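(* In the Schröder case (i.e. $p_1>0$), as $x\to\infty$, $$\liminf_{\varepsilon\downarrow 0}\mathbb{P}\{K-\gamma_s(\varepsilon)>x \mid W<\varepsilon\}\asymp \limsup_{\varepsilon\downarrow 0}\mathbb{P}\{K-\gamma_s(\varepsilon)>x \mid W<\varepsilon\}\asymp p_1^{x}$$ and $$\liminf_{\varepsilon\downarrow 0}\mathbb{P}\{K-\gamma_s(\varepsilon)<-x \mid W<\varepsilon\}\asymp \limsup_{\varepsilon\downarrow 0}\mathbb{P}\{K-\gamma_s(\varepsilon)<-x \mid W<\varepsilon\}\asymp p_1^{(\lambda-1)x},$$ where $\lambda=\min\{k>1: p_k\neq 0\}$.
   Context: Let $X$ be a non-degenerate random variable with values in $\{1,2,\dots\}$, $p_k=\mathbb{P}\{X=k\}$ (so $p_0=0$), with $\mathbb{E}X\log X<\infty$; put $a=\mathbb{E}X\in(1,\infty)$. Let $(Z_n)_{n\ge 0}$ be the Galton–Watson process with offspring distribution $(p_k)$ and $Z_0=1$. The martingale limit $W=\lim_{n\to\infty}Z_n/a^n$ exists and is strictly positive almost surely. The Schröder case means $p_1>0$. In that case the minimal offspring number is $1$ and $K=\min\{n: Z_n>1\}$ is the first generation in which the process exceeds its minimal possible value. Put $\gamma_s(\varepsilon)=\frac{\log(1/\varepsilon)}{\log a}$. The notation $g(x)\asymp h(x)$ as $x\to\infty$ means that $g(x)/h(x)$ is bounded between two positive finite constants for all sufficiently large $x$. *)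

(* Defs.v *)
From HB Require Import structures.
From mathcomp Require Import all_boot all_order all_algebra.
From mathcomp Require Import all_classical all_reals all_analysis.
Set Implicit Arguments.
Unset Strict Implicit.
Unset Printing Implicit Defensive.
Import Order.TTheory GRing.Theory Num.Theory.
Import numFieldNormedType.Exports.
Local Open Scope classical_set_scope.
Local Open Scope ring_scope.

Section Probability.
Context (d : measure_display) (T : measurableType d) (R : realType).
Variable P : probability T R.

Definition nat_pmf (X : T -> nat) (k : nat) : R := fine (P (X @^-1` [set k])).

Definition nat_mean (X : T -> nat) : R := fine 'E_P[(fun w => (X w)%:R : R)%R].

(* [ln 0 = 0] in the library, so a possible value 0 contributes nothing. *)
Definition mean_xlogx (X : T -> nat) : \bar R :=
  'E_P[(fun w => (X w)%:R * ln (X w)%:R : R)%R].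

Definition mutually_independent (I : eqType) (X : I -> T -> nat) :=
  forall (s : seq I) (B : I -> set nat), uniq s ->
    P (\bigcap_(i in [set` s]) (X i @^-1` B i)) =
    (\prod_(i <- s) P (X i @^-1` B i))%E.

(* Elementary conditional probability; it is only meaningful if [P B] is
   nonzero ([x / 0 = 0] in the library). *)
Definition cond_prob (A B : set T) : R := fine (P (A `&` B)) / fine (P B).

End Probability.

Section GaltonWatson.
Context (T : Type) (R : realType).

(* [xi (n, i)] is the number of children of the [i]-th individual of
   generation [n]. *)
Fixpoint galton_watson (xi : nat * nat -> T -> nat) (n : nat) (w : T) : nat :=
  if n is m.+1 then (\sum_(i < galton_watson xi m w) xi (m, val i) w)%N else 1%N.

(* The infimum over the empty set is [+oo]. *)
Definition first_exceed (Z : nat -> T -> nat) (w : T) : \bar R :=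
  ereal_inf [set (n%:R)%:E | n in [set n | (1 < Z n w)%N]].

End GaltonWatson.

Definition gamma_s (R : realType) (a eps : R) : R := ln (1 / eps) / ln a.

Definition is_least (A : set nat) (m : nat) :=
  A m /\ forall k, A k -> (m <= k)%N.

(* Since [x / 0 = 0], the lower bound forces [h x != 0]. *)
Definition asymp (R : realType) (g h : R -> R) :=
  exists c C : R, [/\ 0 < c, 0 < C &
    \forall x \near +oo, c <= g x / h x <= C].

Definition liminf_0 (R : realType) (f : R -> R) : R :=
  fine (limf_einf (fun eps => (f eps)%:E) 0^'+).

Definition limsup_0 (R : realType) (f : R -> R) : R :=
  fine (limf_esup (fun eps => (f eps)%:E) 0^'+).

(* Main.v *)
(* Let f be the generating function of X and f_n its n-th iterate. By the
   branching property E[1_A s^(Z_(n+l))] = E[1_A f_l(s)^(Z_n)] for every event A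
   of the first n generations, so Laplace transforms of Z_n / a^n restricted to
   such events are governed by iterates of f, and dominated convergence carries
   their bounds over to W.

   The condition E[X log X] < oo enters only through a uniform bound
   f_n(exp(-u / a^n)) <= s0 < 1 (Kesten-Stigum); with f(t) <= p_1 t +
   (1 - p_1) t^lambda it yields f_n(t) = O(p_1^n t) and
   f_n(t) - p_1^n t = O(p_1^n t^lambda) for t <= s0. Writing eps = a^(-gamma),
   Markov's inequality for exp(- W / eps) then gives
     P(W < eps) = O(p_1^gamma),
     P(K <= m, W < eps) = O(p_1^m p_1^(lambda (gamma - m))).
   The matching lower bounds come from explicit scenarios: one individual for
   about gamma generations, respectively one individual up to generation m and
   then exactly lambda individuals up to about generation gamma; after that W < eps
   has probability bounded below. Conditioning divides by P(W < eps), which has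
   the order of p_1^gamma, and m = gamma - x gives the exponents. *)
Require Import Defs.
From HB Require Import structures.
From mathcomp Require Import all_boot all_order all_algebra.
From mathcomp Require Import all_classical all_reals all_analysis.
From mathcomp Require Import measurable_realfun.
From mathcomp Require Import ring lra.
Set Implicit Arguments.
Unset Strict Implicit.
Unset Printing Implicit Defensive.
Import Order.TTheory GRing.Theory Num.Theory.
Import numFieldNormedType.Exports.
Local Open Scope classical_set_scope.
Local Open Scope ring_scope.

Lemma sum_expr_le (R : realType) (r : R) (n : nat) :
  0 <= r < 1 -> \sum_(i < n) r ^+ i <= (1 - r)^-1.
Proof.
case/andP=> r0 r1.
rewrite -div1r ler_pdivlMr ?subr_gt0// mulrC -opprB mulNr -subrX1 opprB.
by rewrite gerBl exprn_ge0.
Qed.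

(** * Iterates of a generating function *)

Section Iterates.
Context (R : realType) (f : R -> R) (p a : R) (lam : nat).
Hypothesis f_itv : forall t : R, 0 <= t <= 1 -> 0 <= f t <= 1.
Hypothesis f_mono : forall s t : R, 0 <= s -> s <= t -> t <= 1 -> f s <= f t.
Hypothesis p_itv : 0 < p < 1.
Hypothesis a_gt1 : 1 < a.
Hypothesis lam_gt1 : (1 < lam)%N.
Hypothesis f_le : forall t : R, 0 <= t <= 1 -> f t <= p * t + (1 - p) * t ^+ lam.
Hypothesis f_ge : forall t : R, 0 <= t <= 1 -> 1 - a * (1 - t) <= f t.

Lemma iter_itv n (t : R) : 0 <= t <= 1 -> 0 <= iter n f t <= 1.
Proof. by move=> t01; elim: n => // n IH; rewrite iterS; exact: f_itv. Qed.

Lemma iter_mono n (s t : R) : 0 <= s -> s <= t -> t <= 1 -> iter n f s <= iter n f t.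
Proof.
move=> s0 st t1; elim: n => // n IH; rewrite !iterS.
have /andP[? _] : 0 <= iter n f s <= 1 by apply: iter_itv; lra.
have /andP[_ ?] : 0 <= iter n f t <= 1 by apply: iter_itv; lra.
exact: f_mono.
Qed.

(** By [f_ge] one application of [f] multiplies the distance to 1 by at most [a]. *)
Lemma iter_ge n (t : R) : 0 <= t <= 1 -> 1 - a ^+ n * (1 - t) <= iter n f t.
Proof.
have a1 := a_gt1.
move=> t01; elim: n => [|n IH]; first by rewrite expr0 mul1r /= subKr.
rewrite iterS exprS; apply: le_trans (f_ge (iter_itv n t01)).
rewrite lerB// -mulrA ler_wpM2l//; first by lra.
by rewrite lerBlDr -lerBlDl.
Qed.

(** Weakening the exponent [lam] to 2 is harmless for first-order decay and isolates the factor
    [p + (1 - p) * t], which tends to [p] with [t]. *)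
Lemma f_le_quadratic (t : R) : 0 <= t <= 1 -> f t <= t * (p + (1 - p) * t).
Proof.
have p01 := p_itv.
move=> t01; apply: le_trans (f_le t01) _.
rewrite mulrDr [t * p]mulrC lerD2l mulrCA ler_wpM2l//; first by lra.
by rewrite -expr2 ler_wiXn2l//; case/andP: t01.
Qed.

Lemma iter_le_id n (t : R) : 0 <= t <= 1 -> iter n f t <= t.
Proof.
have p01 := p_itv.
move=> t01; elim: n => // n IH; apply: le_trans IH; rewrite iterS.
have it := iter_itv n t01; apply: le_trans (f_le_quadratic it) _.
by rewrite ler_piMr//; nra.
Qed.

(** Bootstrap: the iterates first decay at a crude geometric rate [r], so the factors gained in
    successive steps differ from [p] by summable relative errors, and their product is at most a
    constant times [p ^+ n]. *)
Lemma iter_le (s0 : R) : 0 <= s0 < 1 -> exists2 C, 0 < C &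
  forall n (t : R), 0 <= t <= s0 -> iter n f t <= C * p ^+ n * t.
Proof.
have p01 := p_itv.
move=> s01; pose r := p + (1 - p) * s0; pose c := (1 - p) / p.
have r01 : 0 <= r < 1 by rewrite /r; nra.
have c0 : 0 <= c by rewrite /c divr_ge0//; lra.
exists (expR (c * (1 - r)^-1)); first exact: expR_gt0.
move=> n t ts.
have t01 : 0 <= t <= 1 by lra.
have itr k : iter k f t <= r ^+ k * t.
  elim: k => [|k IH]; first by rewrite expr0 mul1r.
  rewrite iterS; apply: le_trans (f_le_quadratic (iter_itv k t01)) _.
  rewrite exprS -mulrA mulrC; apply: ler_pM => //.
  - by have := iter_itv k t01; nra.
  - by have := iter_itv k t01; lra.
  - by have := iter_le_id k t01; rewrite /r; nra.
(* Refined rate: step [k] contributes the factor [p * (1 + c * iter k f t)], bounded by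
   [p * expR (c * r ^+ k)]. *)
have step : iter n f t <= p ^+ n * t * expR (c * \sum_(i < n) r ^+ i).
  elim: n => [|k IH]; first by rewrite big_ord0 mulr0 expR0 expr0 mul1r mulr1.
  rewrite iterS big_ord_recr/= mulrDr expRD.
  apply: le_trans (f_le_quadratic (iter_itv k t01)) _.
  have -> : p + (1 - p) * iter k f t = p * (1 + c * iter k f t).
    by rewrite /c mulrDr mulr1 mulrA mulrCA divff ?mulr1//; lra.
  rewrite mulrCA exprS.
  rewrite [leRHS](_ : _ = p * ((p ^+ k * t * expR (c * \sum_(i < k) r ^+ i)) *
     expR (c * r ^+ k))); last by ring.
  rewrite ler_pM2l; last by lra.
  apply: ler_pM => //; first by have := iter_itv k t01; lra.
    by have := iter_itv k t01; nra.
  apply: le_trans (expR_ge1Dx _).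
  rewrite lerD2l ler_wpM2l//; apply: le_trans (itr k) _.
  by rewrite ler_piMr ?exprn_ge0//; lra.
apply: le_trans step _.
rewrite -[leRHS]mulrA [leRHS]mulrC ler_wpM2l//.
  by rewrite mulr_ge0 ?exprn_ge0//; lra.
by rewrite ler_expR ler_wpM2l// sum_expr_le.
Qed.

(** Variation of constants: the difference [D k] satisfies
    [D k.+1 <= p * D k + (iter k f t) ^+ lam]. By [iter_le] and [lam >= 2] the last term is of order
    [p ^+ (2 * k) * t ^+ lam], so after division by [p ^+ k.+1] the increments form a convergent
    geometric series. *)
Lemma iter_sub_le (s0 : R) : 0 <= s0 < 1 -> exists2 C, 0 < C &
  forall n (t : R), 0 <= t <= s0 -> iter n f t - p ^+ n * t <= C * p ^+ n * t ^+ lam.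
Proof.
have p01 := p_itv.
move=> s01; have [C C0 HC] := iter_le s01.
have Cl : 0 < C ^+ lam / p by rewrite divr_gt0 ?exprn_gt0//; lra.
have p1 : 0 < (1 - p)^-1 by rewrite invr_gt0; lra.
exists (C ^+ lam / p * (1 - p)^-1); first exact: mulr_gt0.
move=> n t ts.
have t01 : 0 <= t <= 1 by lra.
have tl : 0 <= t ^+ lam by rewrite exprn_ge0//; lra.
have pk k : 0 <= p ^+ k by rewrite exprn_ge0//; lra.
(* The partial geometric sum is kept in the induction, so that each step adds exactly its last
   term. *)
suff step : iter n f t - p ^+ n * t <=
    C ^+ lam / p * (\sum_(i < n) p ^+ i) * (p ^+ n * t ^+ lam).
  apply: le_trans step _; rewrite -[leRHS]mulrA.
  rewrite ler_wpM2r ?mulr_ge0// ler_wpM2l ?sum_expr_le//; lra.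
elim: n => [|k IH]; first by rewrite big_ord0 mulr0 mul0r expr0 mul1r subrr.
rewrite iterS big_ord_recr/=.
have it := iter_itv k t01.
have fl : iter k f t ^+ lam <= C ^+ lam * (p ^+ k * p ^+ k) * t ^+ lam.
  apply: (@le_trans _ _ ((C * p ^+ k * t) ^+ lam)).
    apply: lerXn2r; last exact: HC.
      by rewrite nnegrE; lra.
    rewrite nnegrE mulr_ge0//; last by lra.
    by rewrite mulr_ge0// ltW.
  rewrite !exprMn ler_wpM2r// ler_wpM2l//; first by rewrite exprn_ge0// ltW.
  by rewrite -expr2 ler_wiXn2l// exprn_ile1//; lra.
apply: (@le_trans _ _ (p * (iter k f t - p ^+ k * t) + iter k f t ^+ lam)).
  have := f_le it; rewrite exprS; set u := iter k f t in it * => fu.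
  suff : (1 - p) * u ^+ lam <= u ^+ lam by lra.
  by rewrite ler_piMl ?exprn_ge0//; lra.
apply: (@le_trans _ _ (p * (C ^+ lam / p * (\sum_(i < k) p ^+ i) *
   (p ^+ k * t ^+ lam)) + C ^+ lam * (p ^+ k * p ^+ k) * t ^+ lam)).
  by rewrite lerD// ler_wpM2l//; lra.
rewrite le_eqVlt; apply/orP; left; apply/eqP; rewrite exprS; field; lra.
Qed.

(** * The Kesten-Stigum bound *)

Section KestenStigum.
Context (eta : R -> R) (M : R).
Hypothesis eta_ge0 : forall s : R, 0 <= s -> 0 <= eta s.
Hypothesis eta_mono : forall s t : R, 0 <= s -> s <= t -> eta s <= eta t.
Hypothesis f_eta :
  forall s : R, 0 <= s <= 1 -> f (1 - s) <= 1 - a * s * (1 - eta s).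
Hypothesis eta_sum : forall n, \sum_(j < n) eta (a ^- j) <= M.

(** [J'] is chosen so that the partial sum up to it is within 1/2 of the supremum; the later terms
    share what is left. *)
Lemma eta_tail : exists J, forall n, \sum_(j < n) eta (a ^- (J + j)) <= 1 / 2.
Proof.
pose S n := \sum_(j < n) eta (a ^- j).
pose E := range S.
have supE : has_sup E.
  split; first by exists (S 0%N); exists 0%N.
  by exists M => _ [n _ <-]; exact: eta_sum.
have half : 0 < (1 / 2 : R) by lra.
have [_ [J' _ <-] HJ'] := sup_adherent half supE.
exists J' => n.
have : S (J' + n)%N <= sup E by apply: sup_upper_bound => //; exists (J' + n)%N.
rewrite /S big_split_ord/= -/(S J').
lra.
Qed.

(** With [d k = 1 - iter k f (1 - s)], [f_eta] says that [d] grows by the factor [a] up to a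
    relative loss [eta (d k)]. Since [d k <= a ^+ k * s], the losses, read backwards from [n], lie
    in the tail of the series of [eta] and sum to at most 1/2. Hence [d n] stays above a
    constant. *)
Lemma iter_expR_bound : exists u s0 : R, [/\ 0 < u, 0 < s0 < 1 &
  forall n, iter n f (expR (- (u / a ^+ n))) <= s0].
Proof.
have a1 := a_gt1.
have [J HJ] := eta_tail.
have a0 : 0 < a by lra.
have ak k : 0 < a ^+ k by rewrite exprn_gt0.
(* Starting at scale [a ^- J] places all the losses in the tail given by [eta_tail]. *)
pose u := a ^- J; have u0 : 0 < u by rewrite invr_gt0.
have u1 : u <= 1 by rewrite invf_le1 ?exprn_ege1 ?ltW.
(* One factor 1/2 is lost in [v / 2 <= s], the other in the accumulated losses. *)
exists u, (1 - u / 4); split => //; first by lra.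
move=> n; set s := 1 - expR (- (u / a ^+ n)).
pose v := u / a ^+ n.
have v0 : 0 < v by rewrite divr_gt0.
have v1 : v <= 1.
  by rewrite ler_pdivrMr// mul1r (le_trans u1)// exprn_ege1 ?ltW.
have e01 : 0 <= expR (- v) <= 1 by rewrite expR_ge0 -expR0 ler_expR; lra.
have s0 : 0 <= s <= 1 by rewrite /s -/v; lra.
have sv : s <= v by rewrite /s -/v; have := expR_ge1Dx (- v); lra.
have vs : v / 2 <= s.
  have : expR (- v) * (1 + v) <= 1.
    rewrite -[leRHS](expRxMexpNx_1 v) mulrC ler_wpM2r ?expR_ge0//.
    exact: expR_ge1Dx.
  by rewrite /s -/v; nra.
have ee : expR (- v) = 1 - s by rewrite /s subKr.
rewrite -/v ee.
have t01 : 0 <= 1 - s <= 1 by lra.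
pose d k := 1 - iter k f (1 - s).
have d01 k : 0 <= d k <= 1 by have := iter_itv k t01; rewrite /d; lra.
have dle k : d k <= a ^+ k * s.
  by have := iter_ge k t01; rewrite subKr /d; lra.
have eta_le1 k : (k < n)%N -> eta (a ^+ k * s) <= eta (a ^- (J + (n - k))).
  move=> kn; apply: eta_mono; first by rewrite mulr_ge0// ?ltW//; lra.
  apply: (@le_trans _ _ (a ^+ k * v)); first by rewrite ler_pM2l.
  rewrite /v /u exprD invfM mulrCA ler_pM2l// -(subnK (ltnW kn)) exprD addnK.
  by rewrite invfM mulrCA mulfV ?mulr1// lt0r_neq0.
have eta_half : \sum_(i < n) eta (a ^+ i * s) <= 1 / 2.
  (* The indices [n - i] run from 1 to [n], so the term of index 0 of the tail is given away. *)
  apply: le_trans (HJ n.+1); rewrite big_ord_recl/=.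
  apply: (@le_trans _ _ (\sum_(i < n) eta (a ^- (J + i.+1)))); last first.
    by rewrite lerDr eta_ge0// invr_ge0 ltW.
  rewrite (reindex_inj rev_ord_inj)/=; apply: ler_sum => i _.
  have ni : (n - i.+1 < n)%N by rewrite ltn_subrL (leq_ltn_trans _ (ltn_ord i)).
  by apply: le_trans (eta_le1 _ ni) _; rewrite subKn.
have eta_ge k : 0 <= eta (a ^+ k * s).
  by apply: eta_ge0; rewrite mulr_ge0// ?ltW//; lra.
(* The product of the factors [1 - eta (a ^+ i * s)] is bounded below by one minus the sum of the
   losses. *)
have step k : (k <= n)%N ->
    a ^+ k * s * (1 - \sum_(i < k) eta (a ^+ i * s)) <= d k.
  elim: k => [_|k IH kn].
    by rewrite big_ord0 expr0 mul1r subr0 mulr1 /d /= subKr.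
  rewrite big_ord_recr/=.
  have dk : a * d k * (1 - eta (a ^+ k * s)) <= d k.+1.
    have := f_eta (d01 k).
    have -> : f (1 - d k) = 1 - d k.+1 by rewrite /d !subKr.
    have ek : eta (d k) <= eta (a ^+ k * s).
      by apply: eta_mono; rewrite ?dle//; case/andP: (d01 k).
    have ad : 0 <= a * d k.
      by apply: mulr_ge0; [exact: ltW|by case/andP: (d01 k)].
    have := ler_wpM2l ad ek; set q := a * d k; lra.
  apply: le_trans dk.
  have {}IH := IH (ltnW kn).
  have Sk : 0 <= \sum_(i < k) eta (a ^+ i * s) by apply: sumr_ge0.
  have e1 : eta (a ^+ k * s) <= 1 / 2.
    apply: le_trans eta_half; rewrite (bigD1 (Ordinal kn))//= lerDl.
    by apply: sumr_ge0.
  set S := \sum_(i < k) _ in IH Sk *; set e := eta _ in e1 *.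
  have e0 : 0 <= e by exact: eta_ge.
  have ks : 0 <= a ^+ k * s by rewrite mulr_ge0// ?ltW//; lra.
  rewrite exprS -!mulrA ler_pM2l//; rewrite !mulrA.
  set q := a ^+ k * s in IH ks *; have dk0 := d01 k; set x := d k in IH dk0 *.
  apply: (@le_trans _ _ (q * (1 - S) * (1 - e))).
    by have := mulr_ge0 ks (mulr_ge0 Sk e0); lra.
  by apply: ler_wpM2r => //; lra.
have {}step := step n (leqnn n).
have : u / 4 <= d n.
  apply: le_trans step.
  have as_ge : u / 2 <= a ^+ n * s.
    apply: (@le_trans _ _ (a ^+ n * (v / 2))); last by rewrite ler_pM2l.
    by rewrite /v mulrA mulrCA mulfV ?mulr1// lt0r_neq0.
  set S := \sum_(i < n) _ in eta_half *; set q := a ^+ n * s in as_ge *.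
  have q0 : 0 <= q by lra.
  have S1 : 1 / 2 <= 1 - S by lra.
  by have := ler_wpM2l q0 S1; lra.
by rewrite /d; lra.
Qed.
End KestenStigum.
End Iterates.

Lemma set_seq_cons (I : eqType) (j : I) (s : seq I) :
  [set` j :: s] = j |` [set` s].
Proof. by apply/seteqP; split => i /=; rewrite inE => /predU1P. Qed.

(** * Independence from a family of counting variables *)

Section NatValued.
Context (d : measure_display) (T : measurableType d) (R : realType).

Definition nat_measurable (Y : T -> nat) :=
  forall k, measurable (Y @^-1` [set k]).

Lemma preimage_nat_bigcup (Y : T -> nat) (D : set nat) :
  Y @^-1` D = \bigcup_(k in D) Y @^-1` [set k].
Proof.
apply/seteqP; split => [w Dw|w [k Dk /= kw]]; first by exists (Y w).
by rewrite /preimage /= kw.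
Qed.

Lemma setI_preimage_nat_bigcup (A : set T) (Y : T -> nat) :
  A = \bigcup_k (A `&` Y @^-1` [set k]).
Proof. by apply/seteqP; split => [w Aw|w [k _ []]//]; exists (Y w). Qed.

Lemma trivIset_preimage_nat (A : set T) (Y : T -> nat) :
  trivIset setT (fun k => A `&` Y @^-1` [set k]).
Proof. by move=> i j _ _ [w [[_ /= iw] [_ /= jw]]]; rewrite -iw -jw. Qed.

Lemma nat_measurable_preimage (Y : T -> nat) (D : set nat) :
  nat_measurable Y -> measurable (Y @^-1` D).
Proof. by move=> mY; rewrite preimage_nat_bigcup; exact: bigcup_measurable. Qed.

Lemma measurable_fun_nat_comp d' (T' : measurableType d') (Y : T -> nat)
    (h : nat -> T') (A : set T) :
  nat_measurable Y -> measurable_fun A (h \o Y).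
Proof.
move=> mY mA B mB; apply: measurableI => //; rewrite comp_preimage.
exact: nat_measurable_preimage.
Qed.

Variable mu : {measure set T -> \bar R}.

Lemma ge0_integral_nat_partition (Y : T -> nat) (A : set T) (f : T -> \bar R) :
  nat_measurable Y -> measurable A -> measurable_fun A f ->
  (forall w, A w -> (0 <= f w)%E) ->
  (\int[mu]_(w in A) f w =
   \sum_(k <oo) \int[mu]_(w in A `&` Y @^-1` [set k]) f w)%E.
Proof.
move=> mY mA mf f0; rewrite {1 2}(setI_preimage_nat_bigcup A Y).
rewrite ge0_integral_bigcup -?setI_preimage_nat_bigcup//.
- by move=> k; exact: measurableI.
- exact: trivIset_preimage_nat.
Qed.

Lemma measure_nat_partition (Y : T -> nat) (A : set T) :
  nat_measurable Y -> measurable A ->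
  (mu A = \sum_(k <oo) mu (A `&` Y @^-1` [set k]))%E.
Proof.
move=> mY mA; rewrite {1}(setI_preimage_nat_bigcup A Y).
rewrite measure_semi_bigcup -?setI_preimage_nat_bigcup//.
- by move=> k; exact: measurableI.
- exact: trivIset_preimage_nat.
Qed.

End NatValued.

Section Independence.
Context (d : measure_display) (T : measurableType d) (R : realType).
Context (P : probability T R) (I : choiceType) (xi : I -> {RV P >-> nat}).

(** Independence is tested on finite cylinder events only. This class of events is stable under the
    operations needed below, so no generated sigma-algebra has to be formed. *)
Definition independent_of (J : set I) (A : set T) :=
  measurable A /\ forall (s : seq I) (B : I -> set nat),
    uniq s -> [set` s] `<=` J ->
    P (A `&` \bigcap_(i in [set` s]) (xi i @^-1` B i)) =
    (P A * \prod_(i <- s) P (xi i @^-1` B i))%E.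

Lemma RV_nat_measurable (Y : {RV P >-> nat}) : nat_measurable Y.
Proof. by move=> k; rewrite -[_ @^-1` _]setTI; exact: measurable_funP. Qed.
Hint Resolve RV_nat_measurable : core.

Lemma measurable_RV_nat (Y : {RV P >-> nat}) (D : set nat) :
  measurable (Y @^-1` D).
Proof. exact: nat_measurable_preimage. Qed.
Hint Resolve measurable_RV_nat : core.

Lemma prod_probability_fin_num (s : seq I) (B : I -> set nat) :
  (\prod_(i <- s) P (xi i @^-1` B i))%E \is a fin_num.
Proof.
elim/big_ind : _ => // [x y|i _]; first exact: fin_numM.
by rewrite fin_num_measure.
Qed.

Lemma independent_of_sub (J J' : set I) (A : set T) :
  J' `<=` J -> independent_of J A -> independent_of J' A.
Proof.
move=> JJ [mA iA]; split => // s B us sJ; apply: iA => //.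
exact: subset_trans JJ.
Qed.

Lemma independent_of1 (J : set I) (A : set T) (j : I) (C : set nat) :
  J j -> independent_of J A ->
  P (A `&` xi j @^-1` C) = (P A * P (xi j @^-1` C))%E.
Proof.
move=> Jj [mA iA]; have := iA [:: j] (fun=> C) isT.
rewrite set_cons1 bigcap_set1 big_seq1; apply.
by move=> _ ->.
Qed.

(** Coordinate [j] is consumed by the new event and must be removed from [J]. A cylinder over the
    other coordinates becomes one over [j :: s] by putting [C] at [j]. *)
Lemma independent_of_setI (J : set I) (A : set T) (j : I) (C : set nat) :
  J j -> independent_of J A ->
  independent_of (J `\ j) (A `&` xi j @^-1` C).
Proof.
move=> Jj iA; have [mA iA'] := iA.
split; first exact: measurableI.
move=> s B us sJ; rewrite (independent_of1 C Jj iA).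
have js : j \notin s by apply/negP => /sJ[_]; apply.
pose B' i := if i == j then C else B i.
have B's i : i \in s -> B' i = B i.
  by rewrite /B' => is_; case: eqP => // ij; rewrite ij (negbTE js) in is_.
have -> : A `&` xi j @^-1` C `&` \bigcap_(i in [set` s]) (xi i @^-1` B i) =
    A `&` \bigcap_(i in [set` j :: s]) (xi i @^-1` B' i).
  rewrite -setIA set_seq_cons bigcap_setU1; congr (_ `&` (_ `&` _)).
    by rewrite /B' eqxx.
  by apply: eq_bigcapr => i /= is_; rewrite B's.
rewrite iA' /= ?js//; last first.
  by rewrite set_seq_cons => i [->//|/sJ[]].
rewrite big_cons muleA {1}/B' eqxx; congr (_ * _)%E.
by apply: eq_big_seq => i /B's ->.
Qed.

Lemma independent_of_bigcup (J : set I) (F : nat -> set T) :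
  trivIset setT F -> (forall k, independent_of J (F k)) ->
  independent_of J (\bigcup_k F k).
Proof.
move=> tF iF; have mF k : measurable (F k) by have [] := iF k.
split; first exact: bigcup_measurable.
move=> s B us sJ; rewrite setI_bigcupl.
have mC : measurable (\bigcap_(i in [set` s]) (xi i @^-1` B i)).
  by apply: fin_bigcap_measurable => //; exact: finite_seq.
have mFC k : measurable (F k `&` \bigcap_(i in [set` s]) (xi i @^-1` B i)).
  exact: measurableI.
rewrite !measure_semi_bigcup//; first last.
- exact: bigcup_measurable.
- exact: trivIset_setIr.
- exact: bigcup_measurable.
rewrite -(fineK (prod_probability_fin_num s B)) muleC -nneseriesZl//.
apply: eq_eseriesr => k _; have [_ iFk] := iF k.
by rewrite muleC fineK ?prod_probability_fin_num//; exact: iFk.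
Qed.

(** Induction on [r]: the event is split along the value [c] of the first variable, and the rest of
    the sum must then lie in [D] shifted by [c]. This is why [A], [J] and [D] vary in the
    induction. *)
Lemma independent_of_sum (J : set I) (A : set T) (r : seq I) (D : set nat) :
  uniq r -> [set` r] `<=` J -> independent_of J A ->
  independent_of (J `\` [set` r])
    (A `&` (fun w => \sum_(i <- r) xi i w)%N @^-1` D).
Proof.
elim: r J A D => [|j r IH] J A D /=.
  move=> _ _ iA; rewrite set_nil setD0.
  have [D0|D0] := pselect (D 0%N).
    rewrite (_ : _ @^-1` _ = setT) ?setIT//.
    by apply/seteqP; split => w //= _; rewrite big_nil.
  rewrite (_ : _ @^-1` _ = set0) ?setI0.
    by split => // s B us sJ; rewrite set0I measure0 mul0e.
  by apply/seteqP; split => w //=; rewrite big_nil.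
move=> /andP[jr ur] rJ iA.
have Jj : J j by apply: rJ => /=; rewrite mem_head.
rewrite [X in independent_of _ X](_ : _ = \bigcup_c
    ((A `&` xi j @^-1` [set c]) `&`
    (fun w => \sum_(i <- r) xi i w)%N @^-1` [set m | D (c + m)%N])).
  apply: independent_of_bigcup.
    by move=> i k _ _ [w [[[_ /= iw] _] [[_ /= kw] _]]]; rewrite -iw -kw.
  move=> c; have := IH (J `\ j) (A `&` xi j @^-1` [set c]) [set m | D (c + m)%N].
  move=> /(_ ur) H; apply: independent_of_sub (H _ _).
  - by rewrite set_seq_cons setDDl.
  - move=> i /= ir; split; first by apply: rJ => /=; rewrite inE ir orbT.
    by move=> ij; rewrite -ij ir in jr.
  - exact: independent_of_setI.
apply/seteqP; split => [w [Aw /=]|w [c _ [[Aw /= <-] /=]]].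
  by rewrite big_cons => Dw; exists (xi j w).
by move=> Dw; split => //=; rewrite big_cons.
Qed.

End Independence.

(** * The branching property *)

Section Pgf.
Context (d : measure_display) (T : measurableType d) (R : realType).
Context (P : probability T R) (X : {RV P >-> nat}).

Definition pgf (s : R) : R := fine (\int[P]_w (s ^+ X w)%:E).

Lemma integral_pow_cst (Y : T -> nat) (A : set T) (s : R) (c : nat) :
  measurable A -> A `<=` Y @^-1` [set c] ->
  (\int[P]_(w in A) (s ^+ Y w)%:E = (s ^+ c)%:E * P A)%E.
Proof.
move=> mA AY; rewrite -integral_cst//; apply: eq_integral => w wA.
by rewrite (AY w)//; exact/set_mem.
Qed.

Lemma measurable_pow (Y : T -> nat) (A : set T) (s : R) :
  nat_measurable Y -> measurable_fun A (fun w => (s ^+ Y w)%:E).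
Proof.
move=> mY; exact: (@measurable_fun_nat_comp _ _ _ _ Y (fun k => (s ^+ k)%:E)).
Qed.

Lemma integral_pow_le (Y : T -> nat) (A : set T) (s : R) :
  nat_measurable Y -> measurable A -> 0 <= s <= 1 ->
  (0 <= \int[P]_(w in A) (s ^+ Y w)%:E <= P A)%E.
Proof.
move=> mY mA s01; have [s0 s1] := andP s01.
rewrite integral_ge0/=; last by move=> w _; rewrite lee_fin exprn_ge0.
rewrite -[leRHS]mul1e -integral_cst//; apply: ge0_le_integral => //=.
- by move=> w _; rewrite lee_fin exprn_ge0.
- exact: measurable_pow.
- by move=> w _; rewrite lee_fin exprn_ile1.
Qed.

Lemma pgfE (s : R) : 0 <= s <= 1 ->
  (pgf s)%:E = (\int[P]_w (s ^+ X w)%:E)%E.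
Proof.
move=> s01; rewrite /pgf fineK//.
have /andP[ge0 le1] := integral_pow_le (RV_nat_measurable X) measurableT s01.
by rewrite ge0_fin_numE// (le_lt_trans le1)// (@probability_setT _ _ _ P) ltry.
Qed.

Lemma pgf_itv (s : R) : 0 <= s <= 1 -> 0 <= pgf s <= 1.
Proof.
move=> s01.
have := integral_pow_le (RV_nat_measurable X) measurableT s01.
by rewrite -pgfE// (@probability_setT _ _ _ P) !lee_fin.
Qed.

Lemma pgf_series (s : R) : 0 <= s <= 1 ->
  ((pgf s)%:E = \sum_(k <oo) (s ^+ k)%:E * P (X @^-1` [set k]))%E.
Proof.
move=> s01; have /andP[s0 s1] := s01.
rewrite pgfE// (ge0_integral_nat_partition _ (RV_nat_measurable X))//.
- apply: eq_eseriesr => k _; rewrite setTI; apply: integral_pow_cst => //.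
  exact: measurable_RV_nat.
- exact: measurable_pow (RV_nat_measurable X).
- by move=> w _; rewrite lee_fin exprn_ge0.
Qed.

Context (I : choiceType) (xi : I -> {RV P >-> nat}).
Hypothesis xi_law : forall i k, nat_pmf P (xi i) k = nat_pmf P X k.

Lemma xi_lawE i k : P (xi i @^-1` [set k]) = P (X @^-1` [set k]).
Proof.
have fin (Y : {RV P >-> nat}) : P (Y @^-1` [set k]) \is a fin_num.
  by apply: fin_num_measure; exact: measurable_RV_nat.
by rewrite -[LHS]fineK// -[RHS]fineK//; congr (_%:E); exact: xi_law.
Qed.

(** The first variable is peeled off by partitioning along its value. Each piece of [A] is still
    independent of the remaining variables, so the induction hypothesis applies to it, and summing
    over the values yields one more factor [pgf s]. *)
Lemma independent_integral_pow_sum (J : set I) (A : set T) (r : seq I) (s : R) :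
  independent_of xi J A -> uniq r -> [set` r] `<=` J -> 0 <= s <= 1 ->
  (\int[P]_(w in A) (s ^+ (\sum_(i <- r) xi i w)%N)%:E =
   P A * (pgf s ^+ size r)%:E)%E.
Proof.
move=> iA ur rJ s01; have /andP[s0 s1] := s01; move: iA ur rJ.
elim: r J A => [|j r IH] J A iA /=.
  move=> _ _; rewrite expr0 mule1 -[RHS]mul1e -integral_cst; last by case: iA.
  by apply: eq_integral => w _; rewrite big_nil expr0.
move=> /andP[jr ur] rJ; have [mA _] := iA.
have Jj : J j by apply: rJ => /=; rewrite mem_head.
have g0 : 0 <= pgf s by case/andP: (pgf_itv s01).
have msum (q : seq I) : nat_measurable (fun w => \sum_(i <- q) xi i w)%N.
  elim: q => [|i q IHq] k.
    have [k0|k0] := pselect (0%N = k).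
      rewrite [X in measurable X](_ : _ = setT)//.
      by apply/seteqP; split => w //= _; rewrite big_nil.
    rewrite [X in measurable X](_ : _ = set0)//.
    by apply/seteqP; split => w //=; rewrite big_nil.
  rewrite [X in measurable X](_ : _ = \bigcup_c (xi i @^-1` [set c] `&`
     (fun w => \sum_(i <- q) xi i w)%N @^-1` [set m | (c + m)%N = k])).
    apply: bigcup_measurable => c _; apply: measurableI.
      exact: measurable_RV_nat.
    exact: nat_measurable_preimage.
  apply/seteqP; split => [w /=|w [c _ [/= <- <-]]]; rewrite big_cons//.
  by move=> <-; exists (xi i w).
rewrite (ge0_integral_nat_partition _ (RV_nat_measurable (xi j)))//; first last.
- by move=> w _; rewrite lee_fin exprn_ge0.
- exact: measurable_pow.
transitivity (\sum_(c <oo)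
    ((fine (P A) * pgf s ^+ size r)%:E * ((s ^+ c)%:E * P (X @^-1` [set c]))))%E.
  apply: eq_eseriesr => c _.
  transitivity ((s ^+ c)%:E * \int[P]_(w in A `&` xi j @^-1` [set c])
     (s ^+ (\sum_(i <- r) xi i w)%N)%:E)%E.
    rewrite -ge0_integralZl ?lee_fin ?exprn_ge0//; first last.
    - by move=> w _; rewrite lee_fin exprn_ge0.
    - exact: measurable_pow.
    - by apply: measurableI => //; exact: measurable_RV_nat.
    apply: eq_integral => w /set_mem[_ /= jc].
    by rewrite big_cons jc exprD EFinM.
  rewrite (IH (J `\ j))//.
  - rewrite (independent_of1 _ Jj iA) xi_lawE EFinM fineK ?fin_num_measure//.
    rewrite muleCA -!muleA; congr (_ * _)%E.
    by rewrite muleCA [RHS]muleCA; congr (_ * _)%E; exact: muleC.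
  - exact: independent_of_setI.
  - move=> i /= ir; split; first by apply: rJ => /=; rewrite inE ir orbT.
    by move=> ij; rewrite -ij ir in jr.
rewrite nneseriesZl; last by move=> c _; rewrite mule_ge0// lee_fin exprn_ge0.
rewrite -pgf_series// -EFinM -mulrA -exprSr EFinM fineK//.
exact: fin_num_measure.
Qed.

End Pgf.

Section Branching.
Context (d : measure_display) (T : measurableType d) (R : realType).
Context (P : probability T R) (X : {RV P >-> nat}).
Context (xi : nat * nat -> {RV P >-> nat}).
Hypothesis xi_indep : mutually_independent P xi.
Hypothesis xi_law : forall ni k, nat_pmf P (xi ni) k = nat_pmf P X k.
Local Notation Z := (galton_watson xi).
Local Notation f := (pgf X).

Definition generations_from n : set (nat * nat) := [set i | (n <= i.1)%N].

Definition generation n k : seq (nat * nat) := [seq (n, i) | i <- iota 0 k].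

(* The event [A] is determined by the generations before [n], seen through the
   only property of such events that is used. *)
Definition past n (A : set T) := forall k,
  independent_of xi (generations_from n) (A `&` Z n @^-1` [set k]).

Lemma generation_uniq n k : uniq (generation n k).
Proof. by rewrite map_inj_uniq ?iota_uniq// => i j []. Qed.

Lemma generation_sub n k : [set` generation n k] `<=` generations_from n.
Proof. by move=> _ /= /mapP[i _ ->] /=; rewrite /generations_from/=. Qed.

Lemma generations_fromS n k :
  generations_from n.+1 `<=` generations_from n `\` [set` generation n k].
Proof.
move=> [m i] /= nm; split => /=; first exact: ltnW.
by move=> /mapP[j _ [mn _]]; rewrite /generations_from/= mn ltnn in nm.
Qed.

Lemma galton_watsonS n w :
  Z n.+1 w = (\sum_(i <- generation n (Z n w)) xi i w)%N.
Proof.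
by rewrite big_map /= -(big_mkord xpredT (fun i => xi (n, i) w)) /index_iota subn0.
Qed.

Lemma independent_of_setT J : independent_of xi J setT.
Proof.
split => // s B us _; rewrite setTI (@probability_setT _ _ _ P) mul1e.
exact: xi_indep.
Qed.

(** Once the value of [Z n] is fixed, a condition on [Z n] no longer depends on the sample point;
    intersecting with it gives [A] or the empty set. *)
Lemma independent_of_guard J A (Q : Prop) :
  independent_of xi J A -> independent_of xi J [set w | A w /\ Q].
Proof.
move=> iA; have [q|q] := pselect Q.
  by rewrite (_ : [set _ | _] = A)//; apply/seteqP; split => w // [].
rewrite (_ : [set _ | _] = set0); last by apply/seteqP; split => w // [].
by split => // s B us sJ; rewrite set0I measure0 mul0e.
Qed.

Lemma past0 : past 0 setT.
Proof.
move=> k; rewrite [X in independent_of _ _ X](_ : _ =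
  [set w | setT w /\ 1%N = k]); last by apply/seteqP; split => w [].
exact/independent_of_guard/independent_of_setT.
Qed.

Lemma past_setI n A D : past n A -> past n (A `&` Z n @^-1` D).
Proof.
move=> pA k; rewrite [X in independent_of _ _ X](_ : _ =
  [set w | (A `&` Z n @^-1` [set k]) w /\ D k]).
  exact/independent_of_guard/pA.
apply/seteqP; split => w /=; first by move=> [[Aw Dw] <-].
by move=> [[Aw <-] Dw].
Qed.

Lemma past_measurable n A : past n A -> measurable A.
Proof.
move=> pA; rewrite (setI_preimage_nat_bigcup A (Z n)).
by apply: bigcup_measurable => k _; have [] := pA k.
Qed.

(** On [Z n = k] the next size is a sum over the first [k] individuals of generation [n]. Only these
    variables are consumed, and all generations from [n.+1] on stay independent. *)
Lemma pastS n A : past n A -> past n.+1 A.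
Proof.
move=> pA l; rewrite [X in independent_of _ _ X](_ : _ = \bigcup_k
  ((A `&` Z n @^-1` [set k]) `&`
   (fun w => \sum_(i <- generation n k) xi i w)%N @^-1` [set l])).
  apply: independent_of_bigcup.
    by move=> i j _ _ [w [[[_ /= iw] _] [[_ /= jw] _]]]; rewrite -iw -jw.
  move=> k; apply: independent_of_sub (@generations_fromS n k) _.
  apply: independent_of_sum (pA k); first exact: generation_uniq.
  exact: generation_sub.
apply/seteqP; split => [w [Aw /= Zl]|w [k _ [[Aw /= Zk] /= Sl]]].
  by exists (Z n w) => //=; split=> //; rewrite -galton_watsonS.
by split => //=; rewrite -[LHS]/(Z n.+1 w) galton_watsonS Zk.
Qed.

Lemma past_setT n : past n setT.
Proof. by elim: n => [|n]; [exact: past0|exact: pastS]. Qed.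

Lemma galton_watson_measurable n : nat_measurable (Z n).
Proof. by move=> k; have [] := past_setT n k; rewrite setTI. Qed.

(** On each piece [Z n = k] the next size is a sum of [k] fresh copies of [X], whose generating
    function is [f s ^+ k]. *)
Lemma markov_step n A s : past n A -> 0 <= s <= 1 ->
  (\int[P]_(w in A) (s ^+ Z n.+1 w)%:E = \int[P]_(w in A) (f s ^+ Z n w)%:E)%E.
Proof.
move=> pA s01; have mA := past_measurable pA.
have /andP[s0 s1] := s01; have /andP[f0 f1] := pgf_itv X s01.
have mZ m := galton_watson_measurable m.
rewrite (ge0_integral_nat_partition P (mZ n))//; first last.
- by move=> w _; rewrite lee_fin exprn_ge0.
- exact: measurable_pow (mZ n.+1).
rewrite [RHS](ge0_integral_nat_partition P (mZ n))//; first last.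
- by move=> w _; rewrite lee_fin exprn_ge0.
- exact: measurable_pow.
apply: eq_eseriesr => k _.
have mAk : measurable (A `&` Z n @^-1` [set k]).
  by apply: measurableI => //; exact: mZ.
rewrite [RHS](@integral_pow_cst _ _ _ _ _ _ _ k)//.
transitivity (\int[P]_(w in A `&` Z n @^-1` [set k])
  (s ^+ (\sum_(i <- generation n k) xi i w)%N)%:E)%E.
  apply: eq_integral => w /set_mem[_ /= Zk].
  by rewrite -[in LHS]/(Z n.+1 w) galton_watsonS Zk.
rewrite (independent_integral_pow_sum xi_law (pA k))//.
- by rewrite size_map size_iota muleC.
- exact: generation_uniq.
- exact: generation_sub.
Qed.

Lemma markov_iter n l A s : past n A -> 0 <= s <= 1 ->
  (\int[P]_(w in A) (s ^+ Z (n + l) w)%:E =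
   \int[P]_(w in A) (iter l f s ^+ Z n w)%:E)%E.
Proof.
move=> pA; elim: l s => [|l IH] s s01; first by rewrite addn0.
rewrite addnS markov_step ?IH -?iterSr//; first exact: pgf_itv.
by elim: l {IH} => [|l IH]; rewrite ?addn0// addnS; exact: pastS.
Qed.

(** The scenario counted is that each of the [k] individuals has exactly [c] children; by
    independence it costs one factor per individual. *)
Lemma offspring_cst n A k c : past n A ->
  (P (A `&` Z n @^-1` [set k]) * (nat_pmf P X c ^+ k)%:E <=
   P (A `&` Z n @^-1` [set k] `&` Z n.+1 @^-1` [set (k * c)%N]))%E.
Proof.
move=> pA; have [mA iA] := pA k.
pose C : set T := \bigcap_(i in [set` generation n k]) (xi i @^-1` [set c]).
have mC : measurable C.
  apply: fin_bigcap_measurable; first exact: finite_seq.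
  by move=> i _; exact: measurable_RV_nat.
have -> : (P (A `&` Z n @^-1` [set k]) * (nat_pmf P X c ^+ k)%:E =
    P (A `&` Z n @^-1` [set k] `&` C))%E.
  rewrite iA//; [|exact: generation_uniq|exact: generation_sub].
  congr (_ * _)%E; rewrite big_map.
  under eq_bigr do rewrite (xi_lawE xi_law).
  rewrite big_const_seq count_predT size_iota /nat_pmf.
  elim: k {mA iA C mC} => [|k IH] /=; first by rewrite expr0.
  rewrite -IH exprS EFinM fineK// fin_num_measure//; exact: measurable_RV_nat.
apply: le_measure; rewrite ?inE.
- exact: measurableI.
- by apply: measurableI => //; exact: galton_watson_measurable.
- move=> w [[Aw /= Zk] Cw]; split => //=.
  rewrite -[LHS]/(Z n.+1 w) galton_watsonS Zk.
  rewrite big_seq (eq_bigr (fun=> c)); last by move=> i /Cw.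
  by rewrite -big_seq big_const_seq count_predT size_map size_iota iter_addn_0 mulnC.
Qed.

End Branching.

(** * Elementary inequalities for powers and truncated sums *)

Lemma sum_min_le (R : realType) (a y : R) (n N : nat) :
  1 < a -> 0 <= y <= a ^+ n ->
  \sum_(j < N) Num.min 1 (a ^- j * y) <= n%:R + (1 - a^-1)^-1.
Proof.
move=> a1; have a0 : 0 < a by lra.
have ai : 0 <= a^-1 < 1 by rewrite invr_ge0 ltW//= invf_lt1.
(* Each unit of [n] pays for the first term, which is at most 1, and replaces [y] by [y / a]; for
   [n = 0] a geometric series dominates. *)
elim: n N y => [|n IH] N y.
  rewrite expr0 => y01; rewrite add0r; apply: le_trans (sum_expr_le N ai).
  apply: ler_sum => j _; rewrite ge_min; apply/orP; right.
  rewrite exprVn; apply: ler_piMr; last by case/andP: y01.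
  by rewrite invr_ge0 exprn_ge0// ltW.
move=> /andP[y0 ya].
have c0 : 0 <= (1 - a^-1)^-1 by rewrite invr_ge0; lra.
case: N => [|N]; first by rewrite big_ord0 addr_ge0.
rewrite big_ord_recl/= -natr1 [n%:R + 1]addrC -addrA lerD//.
  by rewrite ge_min lexx.
have ya' : 0 <= a^-1 * y <= a ^+ n.
  have /andP[ai0 _] := ai.
  by rewrite mulr_ge0//= ler_pdivrMl// -exprS.
apply: le_trans (IH N _ ya'); apply: ler_sum => j _.
by rewrite /bump/= add1n exprS invfM mulrA [a^-1 * _]mulrC.
Qed.

Lemma bernoulli_pow (R : realType) (t : R) (k : nat) :
  0 <= t <= 1 -> 1 <= t ^+ k + k%:R * (1 - t).
Proof.
move=> t01; elim: k => [|k IH]; first by rewrite expr0 mul0r addr0.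
rewrite exprS -natr1.
have t0 : 0 <= t by lra.
have := ler_wpM2l t0 IH.
have : 0 <= k%:R * (1 - t) * (1 - t) by rewrite !mulr_ge0//; lra.
by set u := t ^+ k; set m : R := k%:R; lra.
Qed.

(** If [s * k >= 1] the error term alone covers [s * k]. Otherwise it equals [(s * k) ^ 2], and a
    second-order Bernoulli inequality applies. *)
Lemma pow_le_min (R : realType) (s : R) (k : nat) : 0 <= s <= 1 ->
  (1 - s) ^+ k + s * k%:R <= 1 + s * (k%:R * Num.min 1 (s * k%:R)).
Proof.
move=> s01.
have k0 : 0 <= k%:R :> R by [].
have [sk|sk] := leP 1 (s * k%:R).
  rewrite mulr1 lerD2r exprn_ile1//; lra.
have : (1 - s) ^+ k <= 1 - s * k%:R + s ^+ 2 * k%:R ^+ 2.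
  elim: k {k0 sk} => [|k IH]; first by rewrite expr0; lra.
  rewrite exprS -natr1.
  have s1 : 0 <= 1 - s by lra.
  have := ler_wpM2l s1 IH.
  have : 0 <= s ^+ 3 * k%:R ^+ 2 by rewrite mulr_ge0 ?exprn_ge0//; lra.
  have : 0 <= s ^+ 2 * k%:R by rewrite mulr_ge0 ?exprn_ge0//; lra.
  have : 0 <= s ^+ 2 by rewrite exprn_ge0//; lra.
  by set u := (1 - s) ^+ k; set m : R := k%:R; lra.
by set u := (1 - s) ^+ k; set m : R := k%:R; lra.
Qed.

(** * The X log X condition *)

Section OffspringMoments.
Context (d : measure_display) (T : measurableType d) (R : realType).
Context (P : probability T R) (X : {RV P >-> nat}).

Definition mean_of (h : nat -> R) : \bar R := (\int[P]_w (h (X w))%:E)%E.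

Lemma measurable_mean_of (h : nat -> R) (A : set T) :
  measurable_fun A (fun w => (h (X w))%:E).
Proof.
exact: (@measurable_fun_nat_comp _ _ _ _ X (fun k => (h k)%:E) A
  (RV_nat_measurable X)).
Qed.

Lemma mean_of_ge0 (h : nat -> R) : (forall k, 0 <= h k) -> (0 <= mean_of h)%E.
Proof. by move=> h0; apply: integral_ge0 => w _; rewrite lee_fin. Qed.

Lemma mean_of_le (g h : nat -> R) : (forall k, 0 <= g k) ->
  (forall k, g k <= h k) -> (mean_of g <= mean_of h)%E.
Proof.
move=> g0 gh; apply: ge0_le_integral => //.
- by move=> w _; rewrite lee_fin.
- exact: measurable_mean_of.
- exact: measurable_mean_of.
- by move=> w _; rewrite lee_fin.
Qed.

Lemma mean_ofD (g h : nat -> R) : (forall k, 0 <= g k) ->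
  (forall k, 0 <= h k) ->
  (mean_of (fun k => (g k + h k)%R) = mean_of g + mean_of h)%E.
Proof.
move=> g0 h0; rewrite /mean_of -ge0_integralD//.
- by move=> w _; rewrite lee_fin.
- exact: measurable_mean_of.
- by move=> w _; rewrite lee_fin.
- exact: measurable_mean_of.
Qed.

Lemma mean_ofZ (c : R) (h : nat -> R) : 0 <= c -> (forall k, 0 <= h k) ->
  (mean_of (fun k => (c * h k)%R) = c%:E * mean_of h)%E.
Proof.
move=> c0 h0; rewrite /mean_of -ge0_integralZl//.
- exact: measurable_mean_of.
- by move=> w _; rewrite lee_fin.
Qed.

Lemma mean_of_cst (c : R) : mean_of (fun=> c) = c%:E.
Proof.
by rewrite /mean_of integral_cst// [X in (_ * X)%E](@probability_setT _ _ _ P) mule1.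
Qed.

Lemma pgf_mean_of (t : R) : 0 <= t <= 1 ->
  (pgf X t)%:E = mean_of (fun k => t ^+ k).
Proof. exact: pgfE. Qed.

Lemma pgf_mono (s t : R) : 0 <= s -> s <= t -> t <= 1 -> pgf X s <= pgf X t.
Proof.
move=> s0 st t1; rewrite -lee_fin !pgf_mean_of//; [|lra|lra].
apply: mean_of_le => k; first by rewrite exprn_ge0.
by rewrite lerXn2r// nnegrE (le_trans s0).
Qed.

Lemma nat_pmf_itv k : 0 <= nat_pmf P X k <= 1.
Proof.
have mk : measurable (X @^-1` [set k]) by exact: measurable_RV_nat.
rewrite fine_ge0// -lee_fin fineK ?fin_num_measure//.
exact: probability_le1.
Qed.

(** The values of zero mass are countably many. This carries the minimality of [lambda], a statement
    about masses, over to the values of [X]. *)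
Lemma nat_pmf_ae : {ae P, forall w, nat_pmf P X (X w) != 0}.
Proof.
rewrite /almost_everywhere/= /negligible/=.
pose D := [set k | nat_pmf P X k = 0].
exists (X @^-1` D); split; first exact: measurable_RV_nat.
  rewrite (measure_nat_partition P (RV_nat_measurable X)); last first.
    exact: measurable_RV_nat.
  apply: eseries0 => k _ _; have [kD|kD] := pselect (D k).
    apply/eqP; rewrite eq_le measure_ge0 andbT.
    apply: (@le_trans _ _ (P (X @^-1` [set k]))).
      apply: le_measure; rewrite ?inE; last exact: subIsetr.
        by apply: measurableI; exact: measurable_RV_nat.
      exact: measurable_RV_nat.
    rewrite -[leLHS]fineK; first by rewrite lee_fin -/(nat_pmf P X k) kD.
    by apply: fin_num_measure; exact: measurable_RV_nat.
  rewrite (_ : _ `&` _ = set0) ?measure0//.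
  by apply/seteqP; split => w //= [Dw Xw]; apply: kD; rewrite -Xw.
by move=> w /= /negP; rewrite negbK => /eqP.
Qed.

Local Notation p := (nat_pmf P X 1).
Local Notation a := (nat_mean P X).
Local Notation f := (pgf X).

Hypothesis X_pos : nat_pmf P X 0 = 0.
Hypothesis X_nondegenerate : forall k, nat_pmf P X k != 1.
Hypothesis X_logX : (mean_xlogx P X < +oo)%E.
Hypothesis schroder : 0 < p.
Context (lambda : nat).
Hypothesis lambda_least :
  is_least [set k | (1 < k)%N /\ nat_pmf P X k != 0] lambda.

Lemma p1_itv : 0 < p < 1.
Proof.
by rewrite schroder lt_neqAle X_nondegenerate; case/andP: (nat_pmf_itv 1).
Qed.

Lemma lambda_gt1 : (1 < lambda)%N.
Proof. by case: lambda_least => -[]. Qed.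

(** Off [X = 1], almost surely [X >= lambda], because 0 has no mass and [lambda] is the least larger
    value with mass; there [t ^+ X <= t ^+ lambda]. *)
Lemma pgf_le (t : R) : 0 <= t <= 1 ->
  f t <= p * t + (1 - p) * t ^+ lambda.
Proof.
move=> t01; have /andP[t0 t1] := t01.
pose E : set T := X @^-1` [set 1%N].
have mE : measurable E by exact: measurable_RV_nat.
have mCE : measurable (~` E) by exact: measurableC.
rewrite -lee_fin pgfE// -(setUv E) ge0_integral_setU//; first last.
- by rewrite /disj_set setICr.
- by move=> w _; rewrite lee_fin exprn_ge0.
- exact: measurable_mean_of (fun k => t ^+ k) _.
rewrite EFinD; apply: leeD.
  rewrite (@integral_pow_cst _ _ _ _ _ _ _ 1)// expr1 EFinM muleC.
  by rewrite fineK// fin_num_measure.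
apply: (@le_trans _ _ (\int[P]_(w in ~` E) (t ^+ lambda)%:E)%E).
  apply: ae_ge0_le_integral => //.
  - by move=> w _; rewrite lee_fin exprn_ge0.
  - exact: measurable_mean_of (fun k => t ^+ k) _.
  - by move=> w _; rewrite lee_fin exprn_ge0.
  apply: filterS nat_pmf_ae => w pw Ew; rewrite lee_fin ler_wiXn2l//.
  case: lambda_least => _; apply; split => //.
  have := Ew; rewrite /E/=; case: (X w) pw => [|[|n]]//.
  by rewrite X_pos eqxx.
rewrite integral_cst// [X in (_ * X)%E](@probability_setC _ _ _ P)// EFinM muleC.
by rewrite EFinB fineK// fin_num_measure.
Qed.

(** For [k >= 2] one has [k <= k * ln k / ln 2], and the smaller values are covered by the constant
    1. *)
Lemma mean_of_id_lty : (mean_of (fun k => k%:R) < +oo)%E.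
Proof.
have ln2 : 0 < ln 2 :> R by rewrite ln_gt0//; lra.
have kl k : 0 <= k%:R * ln k%:R :> R.
  by case: k => [|k]; rewrite ?mul0r// mulr_ge0// ln_ge0// ler1n.
apply: (@le_lt_trans _ _ (mean_of (fun k => 1 + (ln 2)^-1 * (k%:R * ln k%:R)))).
  apply: mean_of_le => // k.
  case: k => [|[|k]]; first by rewrite mul0r mulr0 addr0.
    by rewrite ln1 mulr0 mulr0 addr0.
  rewrite mulrCA -[leLHS]mulr1.
  apply: (@le_trans _ _ (k.+2%:R * ((ln 2)^-1 * ln k.+2%:R))).
    rewrite ler_wpM2l// ler_pdivlMl// mulr1 ler_ln ?posrE// ler_nat//.
  by rewrite lerDr.
rewrite mean_ofD//; last by move=> k; rewrite mulr_ge0// invr_ge0 ltW.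
rewrite mean_of_cst mean_ofZ ?invr_ge0 ?(ltW ln2)//.
rewrite lte_add_pinfty ?ltry//.
move: X_logX; rewrite /mean_xlogx unlock => H.
by apply: lte_mul_pinfty => //; rewrite lee_fin invr_ge0 ltW.
Qed.

Lemma nat_meanE : a%:E = mean_of (fun k => k%:R).
Proof.
rewrite /nat_mean unlock fineK//.
by rewrite ge0_fin_numE ?mean_of_id_lty// mean_of_ge0.
Qed.

Lemma pgf_ge (t : R) : 0 <= t <= 1 -> 1 - a * (1 - t) <= f t.
Proof.
move=> t01; have /andP[t0 t1] := t01.
rewrite lerBlDr -lee_fin EFinD EFinM pgf_mean_of// nat_meanE muleC.
rewrite -mean_ofZ//; last by lra.
rewrite -mean_ofD; [|by move=> k; rewrite exprn_ge0
                    |by move=> k; rewrite mulr_ge0//; lra].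
rewrite -(mean_of_cst 1); apply: mean_of_le => // k.
by rewrite mulrC; exact: bernoulli_pow.
Qed.

(** At [t = 1/2] the two bounds on [f] give [1 - a / 2 <= p / 2 + (1 - p) / 4], and the right side
    is less than 1/2 because [p < 1]. *)
Lemma nat_mean_gt1 : 1 < a.
Proof.
have h : 0 <= (1 / 2 : R) <= 1 by lra.
have := pgf_ge h; have := pgf_le h; have p01 := p1_itv.
have : (1 / 2 : R) ^+ lambda <= (1 / 2) ^+ 2.
  by rewrite ler_wiXn2l ?lambda_gt1//; lra.
rewrite expr2; set q := _ ^+ lambda; set b := a; set r := f _; set p' := p in p01 *.
nra.
Qed.

(* The relative error of [1 - f (1 - s) ~ a * s]; its summability along
   [a ^- j] is what the X log X condition provides. *)
Definition eta (s : R) : R :=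
  fine (mean_of (fun k => k%:R * Num.min 1 (s * k%:R))) / a.

Lemma eta_itg_ge0 (s : R) k : 0 <= s -> 0 <= k%:R * Num.min 1 (s * k%:R) :> R.
Proof. by move=> s0; rewrite mulr_ge0// le_min ler01 mulr_ge0. Qed.

Lemma eta_fin (s : R) : 0 <= s ->
  mean_of (fun k => k%:R * Num.min 1 (s * k%:R)) \is a fin_num.
Proof.
move=> s0; rewrite ge0_fin_numE; last first.
  by apply: mean_of_ge0 => k; exact: eta_itg_ge0.
apply: le_lt_trans mean_of_id_lty; apply: mean_of_le => k.
  exact: eta_itg_ge0.
by rewrite ler_piMr// ge_min lexx.
Qed.

Lemma etaE (s : R) : 0 <= s ->
  (a * eta s)%:E = mean_of (fun k => k%:R * Num.min 1 (s * k%:R)).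
Proof.
move=> s0; rewrite /eta mulrCA divff ?mulr1 ?fineK ?eta_fin//.
by have := nat_mean_gt1; case: eqP => // ->; rewrite ltr10.
Qed.

Lemma eta_ge0 (s : R) : 0 <= s -> 0 <= eta s.
Proof.
move=> s0; rewrite divr_ge0//; last by have := nat_mean_gt1; lra.
by rewrite fine_ge0// mean_of_ge0// => k; exact: eta_itg_ge0.
Qed.

Lemma eta_mono (s t : R) : 0 <= s -> s <= t -> eta s <= eta t.
Proof.
move=> s0 st; have a1 := nat_mean_gt1; have t0 : 0 <= t by lra.
rewrite -(ler_pM2l (_ : 0 < a)); last by lra.
rewrite -lee_fin !etaE//; apply: mean_of_le => k; first exact: eta_itg_ge0.
by rewrite ler_wpM2l// le_min !ge_min lexx/= ler_wpM2r ?orbT.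
Qed.

Lemma pgf_eta (s : R) : 0 <= s <= 1 -> f (1 - s) <= 1 - a * s * (1 - eta s).
Proof.
move=> s01; have /andP[s0 s1] := s01.
have e0 k := eta_itg_ge0 k s0.
rewrite [leRHS](_ : _ = 1 + s * (a * eta s) - s * a); last by ring.
rewrite lerBrDr -lee_fin !EFinD !(EFinM s) etaE// nat_meanE pgf_mean_of; last by lra.
rewrite -!mean_ofZ// -(mean_of_cst 1) -!mean_ofD//; first last.
- by move=> k; rewrite mulr_ge0.
- by move=> k; rewrite exprn_ge0// subr_ge0.
- by move=> k; rewrite mulr_ge0.
apply: mean_of_le => k; last exact: pow_le_min.
by rewrite addr_ge0 ?mulr_ge0// exprn_ge0// subr_ge0.
Qed.

(** Summing under the expectation produces [X] times the sum of the [min 1 (a ^- j * X)]. By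
    [sum_min_le] the latter is at most [ln X / ln a] plus a constant, so the X log X moment bounds
    all partial sums. *)
Lemma eta_sum : exists M, forall n, \sum_(j < n) eta (a ^- j) <= M.
Proof.
have a1 := nat_mean_gt1; have a0 : 0 < a by lra.
have lna : 0 < ln a by exact: ln_gt0.
have aj j : 0 <= a ^- j by rewrite invr_ge0 exprn_ge0// ltW.
pose c := (1 - a^-1)^-1.
have c0 : 0 <= c by rewrite invr_ge0 subr_ge0 invf_le1// ltW.
have kl k : 0 <= k%:R * ln k%:R :> R.
  by case: k => [|k]; rewrite ?mul0r// mulr_ge0// ln_ge0// ler1n.
pose B := mean_of (fun k => (ln a)^-1 * (k%:R * ln k%:R) + (1 + c) * k%:R).
have lnai : 0 <= (ln a)^-1 by rewrite invr_ge0 ltW.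
have c1 : 0 <= 1 + c by rewrite addr_ge0.
have h1 k : 0 <= (ln a)^-1 * (k%:R * ln k%:R) by rewrite mulr_ge0.
have h2 k : 0 <= (1 + c) * k%:R by rewrite mulr_ge0.
have Bfin : B \is a fin_num.
  rewrite ge0_fin_numE; last by apply: mean_of_ge0 => k; rewrite addr_ge0.
  rewrite /B mean_ofD// !mean_ofZ// lte_add_pinfty// lte_mul_pinfty ?lee_fin//.
    by move: X_logX; rewrite /mean_xlogx unlock.
  exact: mean_of_id_lty.
exists (fine B / a) => n; rewrite ler_pdivlMr// mulrC mulr_sumr -lee_fin fineK//.
rewrite -sumEFin; under eq_bigr do rewrite etaE//.
rewrite /mean_of -ge0_integral_sum//; first last.
- by move=> j w _; rewrite lee_fin eta_itg_ge0.
- by move=> j; exact: measurable_mean_of (fun k => k%:R * Num.min 1 (a ^- j * k%:R)) _.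
under eq_integral do rewrite sumEFin -mulr_sumr.
apply: (@mean_of_le
  (fun k => k%:R * \sum_(j < n) Num.min 1 (a ^- j * k%:R))) => k.
  rewrite mulr_ge0// sumr_ge0// => j _.
  by rewrite le_min ler01 mulr_ge0.
case: k => [|k]; first by rewrite !mul0r !mulr0 addr0.
rewrite mulrCA [(1 + c) * _]mulrC -mulrDr ler_wpM2l//.
pose y : R := (ln a)^-1 * ln k.+1%:R.
have y0 : 0 <= y by rewrite mulr_ge0 ?invr_ge0 ?(ltW lna)// ln_ge0// ler1n.
(* Rounding the base-[a] logarithm of [k.+1] upwards costs the 1 in the constant [1 + c]. *)
have [m my] : exists m, y <= m%:R <= y + 1.
  exists (Num.truncn y).+1; rewrite ltW ?truncnS_gt//= -natr1 lerD2r.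
  by have /andP[] := truncn_itv y0.
have km : (0 : R) <= k.+1%:R <= a ^+ m.
  rewrite ler0n/= -ler_ln ?posrE ?exprn_gt0// lnXn//.
  have : y * ln a <= m%:R * ln a by rewrite ler_wpM2r ?(ltW lna)//; lra.
  by rewrite /y mulrC mulrA mulfV ?mul1r ?lt0r_neq0// mulr_natl.
apply: le_trans (sum_min_le n a1 km) _.
rewrite -/y -/c; lra.
Qed.

End OffspringMoments.

(** * Small values of the martingale limit *)

Section SmallValues.
Context (d : measure_display) (T : measurableType d) (R : realType).
Context (P : probability T R) (X : {RV P >-> nat}).
Context (xi : nat * nat -> {RV P >-> nat}) (W : {RV P >-> R}).
Local Notation Z := (galton_watson xi).
Local Notation f := (pgf X).
Local Notation p := (nat_pmf P X 1).
Local Notation a := (nat_mean P X).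
Hypothesis X_pos : nat_pmf P X 0 = 0.
Hypothesis X_nondegenerate : forall k, nat_pmf P X k != 1.
Hypothesis X_logX : (mean_xlogx P X < +oo)%E.
Hypothesis xi_indep : mutually_independent P xi.
Hypothesis xi_law : forall ni k, nat_pmf P (xi ni) k = nat_pmf P X k.
Hypothesis W_lim : {ae P, forall w, (Z n w)%:R / a ^+ n @[n --> \oo] --> W w}.
Hypothesis schroder : 0 < p.
Context (lambda : nat).
Hypothesis lambda_least :
  is_least [set k | (1 < k)%N /\ nat_pmf P X k != 0] lambda.

Let p01 : 0 < p < 1 := p1_itv X_nondegenerate schroder.
Let lam1 : (1 < lambda)%N := lambda_gt1 lambda_least.
Let a1 : 1 < a :=
  nat_mean_gt1 X_pos X_nondegenerate X_logX schroder lambda_least.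
Let f_itv := pgf_itv X.
Let f_mono := @pgf_mono _ _ _ P X.
Let f_le := pgf_le X_pos lambda_least.
Let f_ge := pgf_ge X_logX.
Let mZ := galton_watson_measurable xi_indep.

Lemma mean_pow_gt0 n : 0 < a ^+ n.
Proof. by rewrite exprn_gt0//; have := a1; lra. Qed.
Hint Resolve mean_pow_gt0 : core.

Definition prob (A : set T) : R := fine (P A).

Lemma probE (A : set T) : measurable A -> (prob A)%:E = P A.
Proof. by move=> mA; rewrite fineK// fin_num_measure. Qed.

Lemma prob_ge0 (A : set T) : 0 <= prob A.
Proof. exact: fine_ge0. Qed.

Lemma prob_le (A B : set T) : measurable A -> measurable B -> A `<=` B ->
  prob A <= prob B.
Proof.
by move=> mA mB AB; rewrite -lee_fin !probE// le_measure// inE.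
Qed.

Definition W_below (eps : R) : set T := [set w | W w < eps].

Lemma W_below_measurable eps : measurable (W_below eps).
Proof.
rewrite (_ : W_below eps = W @^-1` `]-oo, eps[); last first.
  by apply/seteqP; split => w /=; rewrite in_itv.
by rewrite -[X in measurable X]setTI; exact: measurable_funP.
Qed.

(* The point at which the generating function of [Z n] equals the Laplace
   transform of [Z n / a ^+ n] at [1 / eps]. *)
Definition laplace_point (eps : R) n : R := expR (- (eps^-1 / a ^+ n)).

Lemma laplace_point_itv eps n : 0 < eps -> 0 <= laplace_point eps n <= 1.
Proof.
move=> e0; rewrite expR_ge0 -expR0 ler_expR oppr_le0.
by rewrite divr_ge0// ?invr_ge0 ltW.
Qed.

(** Seen from generation [m], the level [eps] is rescaled to [a ^+ m * eps]. *)
Lemma laplace_pointD eps m n :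
  laplace_point eps (m + n) = laplace_point (a ^+ m * eps) n.
Proof.
by rewrite /laplace_point exprD !invfM mulrA [eps^-1 * _]mulrC.
Qed.

Lemma W_ge0_ae : {ae P, forall w, 0 <= W w}.
Proof.
apply: filterS W_lim => w Ww; apply: (cvgr_to_ge Ww); apply: nearW => n.
by rewrite divr_ge0// ltW.
Qed.

Lemma laplace_measurable eps (A : set T) :
  measurable_fun A (fun w => (expR (- (W w / eps)))%:E).
Proof.
apply/measurable_EFinP; apply: measurable_funTS.
apply: (measurableT_comp (@measurable_expR R)).
apply: measurable_funN; apply: measurable_funM => //.
Qed.

(** The integrand is [expR (- (Z n / a ^+ n / eps))], which converges almost surely and is dominated
    by 1. *)
Lemma laplace_cvg eps (A : set T) : 0 < eps -> measurable A ->
  (\int[P]_(w in A) (laplace_point eps n ^+ Z n w)%:E)%E @[n --> \oo] -->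
  (\int[P]_(w in A) (expR (- (W w / eps)))%:E)%E.
Proof.
move=> e0 mA.
have [] // := @dominated_convergence _ _ _ P A mA
  (fun n w => (laplace_point eps n ^+ Z n w)%:E)
  (fun w => (expR (- (W w / eps)))%:E) (cst 1%:E).
- by move=> n; exact: measurable_pow (mZ n).
- exact: laplace_measurable.
- apply: filterS W_lim => w Ww _; apply: cvg_EFin; first exact: nearW.
  have : expR (- ((Z n w)%:R / a ^+ n / eps)) @[n --> \oo] -->
      expR (- (W w / eps)).
    apply: continuous_cvg; first exact: continuous_expR.
    by apply: cvgN; apply: cvgMl.
  apply: cvg_trans; apply: near_eq_cvg; apply: nearW => n /=.
  rewrite /laplace_point -expRM_natl; congr expR.
  by rewrite mulrN; congr (- _); rewrite -mulrA [eps^-1 * _]mulrC.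
- exact: finite_measure_integrable_cst.
- apply: nearW => w n _ /=; have /andP[s0 s1] := laplace_point_itv n e0.
  by rewrite lee_fin ger0_norm ?exprn_ge0// exprn_ile1.
Qed.

(** Markov's inequality: [expR (- (W / eps))] is at least [expR (- 1)] where [W < eps]. *)
Lemma prob_W_below_le eps (A : set T) (c : R) n0 : 0 < eps -> measurable A ->
  (forall n, (n0 <= n)%N ->
    (\int[P]_(w in A) (laplace_point eps n ^+ Z n w)%:E <= c%:E)%E) ->
  prob (A `&` W_below eps) <= expR 1 * c.
Proof.
move=> e0 mA Hc.
have mB : measurable (A `&` W_below eps).
  by apply: measurableI => //; exact: W_below_measurable.
have Lc : (\int[P]_(w in A) (expR (- (W w / eps)))%:E <= c%:E)%E.
  apply: (cvge_to_le (laplace_cvg e0 mA)).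
  by exists n0.
rewrite -[leLHS](mulKf (lt0r_neq0 (expR_gt0 (-1)))) -expRN opprK.
rewrite ler_pM2l ?expR_gt0// -lee_fin EFinM probE// -integral_cst//.
apply: le_trans Lc.
apply: (@le_trans _ _
    (\int[P]_(w in A `&` W_below eps) (expR (- (W w / eps)))%:E)%E).
  apply: ge0_le_integral => //.
  - by move=> w _; rewrite lee_fin expR_ge0.
  - exact: laplace_measurable.
  - move=> w [_ We]; rewrite lee_fin ler_expR lerN2 ler_pdivrMr// mul1r.
    exact: ltW.
by apply: ge0_subset_integral => //; exact: laplace_measurable.
Qed.

(** Where [W < eps] the Laplace integrand is at most 1, since [W >= 0] almost surely; elsewhere it
    is at most [expR (- 1) <= 1 / 2]. A Laplace integral above half of [prob A] must therefore put
    mass on [W < eps]. *)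
Lemma prob_W_below_ge eps (A : set T) (v : R) n0 : 0 < eps -> measurable A ->
  (forall n, (n0 <= n)%N ->
    (v%:E <= \int[P]_(w in A) (laplace_point eps n ^+ Z n w)%:E)%E) ->
  v - 1 / 2 * prob A <= prob (A `&` W_below eps).
Proof.
move=> e0 mA Hv.
have mWe := W_below_measurable eps.
have mB : measurable (A `&` W_below eps) by exact: measurableI.
have mD : measurable (A `\` W_below eps) by exact: measurableD.
have : (v%:E <= \int[P]_(w in A) (expR (- (W w / eps)))%:E)%E.
  apply: (cvge_to_ge (laplace_cvg e0 mA)).
  by exists n0.
rewrite -{1}(setUIDK A (W_below eps)) ge0_integral_setU//; first last.
- by apply/eqP/seteqP; split => w //= -[[_ h] [_ nh]].
- exact: laplace_measurable.
have I1 : (\int[P]_(w in A `&` W_below eps) (expR (- (W w / eps)))%:E <=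
           (prob (A `&` W_below eps))%:E)%E.
  rewrite probE// -[leRHS]mul1e -integral_cst//; apply: ae_ge0_le_integral => //.
  - exact: laplace_measurable.
  - apply: filterS W_ge0_ae => w W0 _.
    by rewrite lee_fin -expR0 ler_expR oppr_le0 divr_ge0// ltW.
have I2 : (\int[P]_(w in A `\` W_below eps) (expR (- (W w / eps)))%:E <=
           (1 / 2 * prob A)%:E)%E.
  apply: (@le_trans _ _ ((1 / 2)%:E * P (A `\` W_below eps))%E); last first.
    rewrite [leRHS]EFinM probE//; apply: lee_wpmul2l; first by rewrite lee_fin; lra.
    by apply: le_measure; rewrite ?inE.
  rewrite -integral_cst//; apply: ge0_le_integral => //.
  - exact: laplace_measurable.
  - move=> w [_ /negP]; rewrite -leNgt => We; rewrite lee_fin.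
    apply: (@le_trans _ _ (expR (- 1))).
      by rewrite ler_expR lerN2 ler_pdivlMr// mul1r.
    rewrite expRN div1r lef_pV2 ?posrE ?expR_gt0//.
    by apply: le_trans (expR_ge1Dx 1); lra.
move=> /le_trans /(_ (leeD I1 I2)).
by rewrite -EFinD lee_fin; lra.
Qed.

Lemma markov_cst m n (A : set T) (s : R) : past xi m A -> 0 <= s <= 1 ->
  A `<=` Z m @^-1` [set n] -> forall l,
  (\int[P]_(w in A) (s ^+ Z (m + l) w)%:E =
   (iter l f s ^+ n * prob A)%:E)%E.
Proof.
move=> pA s01 An l; have mA := past_measurable pA.
rewrite (markov_iter xi_indep xi_law)// (integral_pow_cst _ _ mA An).
by rewrite EFinM probE.
Qed.

Lemma offspring_prob m k c (A : set T) : past xi m A ->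
  A `<=` Z m @^-1` [set k] ->
  prob A * nat_pmf P X c ^+ k <= prob (A `&` Z m.+1 @^-1` [set (k * c)%N]).
Proof.
move=> pA Ak; have mA := past_measurable pA.
have := offspring_cst xi_indep xi_law k c pA.
rewrite (setIidl Ak) -(probE mA) -probE; last first.
  by apply: measurableI => //; exact: mZ.
by rewrite -EFinM lee_fin.
Qed.

Definition singles m : set T :=
  [set w | forall j, (j <= m)%N -> Z j w = 1%N].

Definition branching m n : set T :=
  singles m `&` [set w | forall j, (j <= n)%N -> Z (m.+1 + j) w = lambda].

Lemma singles_cst m : singles m `<=` Z m @^-1` [set 1%N].
Proof. by move=> w; exact. Qed.

Lemma singlesS m : singles m.+1 = singles m `&` Z m.+1 @^-1` [set 1%N].
Proof.
apply/seteqP; split => [w Bw|w [Bw Zw] j].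
  by split => [j jm|]; [apply/Bw/leqW|exact: (Bw m.+1)].
by rewrite leq_eqVlt => /predU1P[->//|]; exact: Bw.
Qed.

Lemma past_singles m : past xi m (singles m).
Proof.
elim: m => [|m IH]; last first.
  by rewrite singlesS; apply: past_setI; exact: pastS.
rewrite (_ : singles 0 = setT); first exact: past_setT.
by apply/seteqP; split => w // _ j; rewrite leqn0 => /eqP ->.
Qed.

Lemma singles_measurable m : measurable (singles m).
Proof. exact: past_measurable (past_singles m). Qed.

Lemma singles_ge m : p ^+ m <= prob (singles m).
Proof.
have p0 : 0 <= p by have := p01; lra.
elim: m => [|m IH].
  rewrite (_ : singles 0 = setT); last first.
    by apply/seteqP; split => w // _ j; rewrite leqn0 => /eqP ->.
  by rewrite expr0 /prob (@probability_setT _ _ _ P).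
rewrite singlesS exprSr.
have := offspring_prob 1 (@past_singles m) (@singles_cst m).
by rewrite expr1 muln1; apply: le_trans; exact: ler_wpM2r.
Qed.

Lemma branching0 m :
  branching m 0 = singles m `&` Z m.+1 @^-1` [set lambda].
Proof.
apply/seteqP; split => [w [Bw Lw]|w [Bw Zw]]; split => //=.
  by have := Lw 0%N isT; rewrite addn0.
by move=> j; rewrite leqn0 => /eqP ->; rewrite addn0.
Qed.

Lemma branchingS m n :
  branching m n.+1 = branching m n `&` Z (m.+1 + n.+1) @^-1` [set lambda].
Proof.
apply/seteqP; split => [w [Bw Lw]|w [[Bw Lw] Zw]].
  split; last by apply: Lw.
  by split => // j jn; apply: Lw; exact: leqW.
by split => // j; rewrite leq_eqVlt => /predU1P[->//|]; exact: Lw.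
Qed.

Lemma branching_cst m n : branching m n `<=` Z (m.+1 + n) @^-1` [set lambda].
Proof. by move=> w [_]; exact. Qed.

Lemma past_branching m n : past xi (m.+1 + n) (branching m n).
Proof.
elim: n => [|n IH].
  rewrite addn0 branching0; apply: past_setI.
  exact: pastS (past_singles m).
by rewrite branchingS addnS; apply: past_setI; exact: pastS.
Qed.

Lemma branching_measurable m n : measurable (branching m n).
Proof. exact: past_measurable (past_branching m n). Qed.

(** Each of the first [m] steps costs [p], the branching step costs the mass of [lambda], and each
    later step costs [p] for every one of the [lambda] individuals. *)
Lemma branching_ge m n :
  p ^+ m * nat_pmf P X lambda * (p ^+ lambda) ^+ n <= prob (branching m n).
Proof.
have p0 : 0 <= p by have := p01; lra.
elim: n => [|n IH].
  rewrite expr0 mulr1 branching0.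
  have := offspring_prob lambda (@past_singles m) (@singles_cst m).
  rewrite expr1 mul1n; apply: le_trans; apply: ler_wpM2r.
    by case/andP: (nat_pmf_itv X lambda).
  exact: singles_ge.
rewrite branchingS exprSr mulrA addnS.
have := offspring_prob 1 (@past_branching m n) (@branching_cst m n).
rewrite muln1; apply: le_trans; apply: ler_wpM2r => //.
exact: exprn_ge0.
Qed.

(** Starting from [k] individuals in generation [m], Bernoulli's inequality and [iter_ge] bound the
    Laplace loss by [k / (a ^+ m * eps) <= 1 / 4]. The integral is then at least 3/4 of [prob A], of
    which [prob_W_below_ge] gives up 1/2. *)
Lemma prob_W_below_cst m k (A : set T) eps : past xi m A ->
  A `<=` Z m @^-1` [set k] -> 0 < eps -> 4 * k%:R <= a ^+ m * eps ->
  1 / 4 * prob A <= prob (A `&` W_below eps).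
Proof.
move=> pA Ak e0 ke; have mA := past_measurable pA.
have := @prob_W_below_ge eps A (3 / 4 * prob A) m e0 mA.
set b := prob (_ `&` _) => H.
suff : 3 / 4 * prob A - 1 / 2 * prob A <= b by lra.
apply: H => n mn; rewrite -(subnKC mn); set l := (n - m)%N.
have s01 := @laplace_point_itv eps (m + l) e0.
rewrite (markov_cst pA s01 Ak) lee_fin ler_wpM2r ?prob_ge0//.
set s := laplace_point _ _ in s01 *.
have fl := iter_ge f_itv a1 f_ge l s01.
have fi := iter_itv f_itv l s01.
set y := iter l f s in fl fi *.
have := bernoulli_pow k fi.
suff : k%:R * (1 - y) <= 1 / 4 by set q := y ^+ k; lra.
have s1 : 1 - s <= eps^-1 / a ^+ (m + l).
  by have := expR_ge1Dx (- (eps^-1 / a ^+ (m + l))); rewrite /s /laplace_point; lra.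
apply: (@le_trans _ _ (k%:R * (a ^+ l * (eps^-1 / a ^+ (m + l))))).
  rewrite ler_wpM2l//; apply: (@le_trans _ _ (a ^+ l * (1 - s))); first by lra.
  by rewrite ler_pM2l.
have -> : a ^+ l * (eps^-1 / a ^+ (m + l)) = (a ^+ m * eps)^-1.
  rewrite exprD; have := (lt0r_neq0 (mean_pow_gt0 m), lt0r_neq0 (mean_pow_gt0 l)).
  set A1 := a ^+ m; set A2 := a ^+ l => -[A10 A20].
  by field; rewrite A10 A20 lt0r_neq0.
rewrite ler_pdivrMr ?mulr_gt0//; lra.
Qed.

(** Every estimate used by the theorem, with the real scale gamma replaced by integers: the
    conditions on [a ^+ n * eps] place [n] above or below gamma up to a constant. The first two
    bounds control the denominator. The third serves large [K], where [Z n <= 1] alone already has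
    the right order; the last two serve small [K]. *)
Lemma small_value_bounds : exists c C u : R, [/\ 0 < c, 0 < C, 0 < u &
  [/\ forall n eps, 0 < eps -> 4 <= a ^+ n * eps ->
        c * p ^+ n <= prob (singles n `&` W_below eps),
      forall n eps, 0 < eps -> u * a ^+ n * eps <= 1 ->
        prob (W_below eps) <= C * p ^+ n,
      forall n, prob (Z n @^-1` [set k | (k <= 1)%N]) <= C * p ^+ n,
      forall m n eps, 0 < eps -> u * a ^+ (m + n) * eps <= 1 ->
        prob (~` singles m `&` W_below eps) <= C * p ^+ (m + n * lambda) &
      forall m n eps, 0 < eps -> 4 * lambda%:R <= a ^+ (m.+1 + n) * eps ->
        c * p ^+ (m + n * lambda) <= prob (branching m n `&` W_below eps)]].
Proof.
have [M HM] := eta_sum X_pos X_nondegenerate X_logX schroder lambda_least.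
have [u [s0 [u0 s01 Hu]]] := iter_expR_bound f_itv a1 f_ge
  (eta_ge0 X_pos X_nondegenerate X_logX schroder lambda_least)
  (eta_mono X_pos X_nondegenerate X_logX schroder lambda_least)
  (pgf_eta X_pos X_nondegenerate X_logX schroder lambda_least) HM.
have s01' : 0 <= s0 < 1 by lra.
have [C1 C10 HC1] := iter_le f_itv p01 lam1 f_le s01'.
have [C2 C20 HC2] := iter_sub_le f_itv p01 lam1 f_le s01'.
have e0 : 0 < expR 1 :> R := expR_gt0 1.
have p0 k : 0 <= p ^+ k by rewrite exprn_ge0//; have := p01; lra.
have C1l : 0 < C2 * C1 ^+ lambda by rewrite mulr_gt0 ?exprn_gt0.
have PT : prob setT = 1 by rewrite /prob (@probability_setT _ _ _ P).
have s0C n : iter n f s0 <= C1 * p ^+ n.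
  apply: le_trans (HC1 n s0 _) _; first by rewrite lexx andbT; lra.
  by rewrite ler_piMr ?mulr_ge0 ?(ltW C10)//; lra.
(* The last [l - n] generations bring the Laplace point below [s0] by the Kesten-Stigum bound at
   level [a ^+ n * eps]; the other [n] iterations then act on [s0]. *)
have lap n l eps : 0 < eps -> u * a ^+ n * eps <= 1 -> (n <= l)%N ->
    iter l f (laplace_point eps l) <= iter n f s0.
  move=> e_gt0 ue nl.
  rewrite -(subnKC nl) iterD laplace_pointD; set k := (l - n)%N.
  have ae : 0 < a ^+ n * eps by rewrite mulr_gt0.
  have /andP[lp0 lp1] := laplace_point_itv k ae.
  apply: (iter_mono f_itv f_mono).
  - by case/andP: (iter_itv f_itv k (laplace_point_itv k ae)).
  - apply: le_trans (Hu k); apply: (iter_mono f_itv f_mono) => //.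
      rewrite ler_expR lerN2 ler_pM2r ?invr_gt0//.
      by rewrite -[leRHS]div1r ler_pdivlMr// mulrA.
    rewrite -expR0 ler_expR oppr_le0 divr_ge0//; exact: ltW.
  - by lra.
have total eps l : 0 < eps ->
    (\int[P]_w (laplace_point eps l ^+ Z l w)%:E =
     (iter l f (laplace_point eps l))%:E)%E.
  move=> e_gt0; have := @markov_cst 0 1 setT _ (past0 xi_indep)
    (laplace_point_itv l e_gt0) _ l.
  by rewrite add0n PT expr1 mulr1; apply.
exists (Num.min (1 / 4) (1 / 4 * nat_pmf P X lambda)),
  (Num.max (Num.max (expR 1 * C1) C1) (expR 1 * (C2 * C1 ^+ lambda))), u.
have pl0 : 0 < nat_pmf P X lambda.
  have [[_ pl] _] := lambda_least.
  by rewrite lt_neqAle eq_sym pl; case/andP: (nat_pmf_itv X lambda).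
split => //.
- by rewrite lt_min; apply/andP; split; lra.
- by rewrite !lt_max C10 orbT.
split.
- move=> n eps e_gt0 ae; apply: (@le_trans _ _ (1 / 4 * prob (singles n))).
    apply: (@le_trans _ _ (1 / 4 * p ^+ n)).
      by rewrite ler_wpM2r// ge_min lexx.
    by rewrite ler_wpM2l ?singles_ge//; lra.
  apply: (prob_W_below_cst (@past_singles n) (@singles_cst n)) => //.
  by rewrite mulr1.
- move=> n eps e_gt0 ue.
  have := @prob_W_below_le eps setT (C1 * p ^+ n) n e_gt0 measurableT.
  rewrite setTI mulrA => H; apply: le_trans (H _) _.
    by move=> l nl; rewrite total// lee_fin (le_trans (lap n l eps _ _ _)).
  by rewrite ler_wpM2r// !le_max lexx.
- move=> n; have mZ1 := nat_measurable_preimage [set k | (k <= 1)%N] (mZ n).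
  apply: (@le_trans _ _ (C1 * p ^+ n)); last first.
    by rewrite ler_wpM2r// !le_max lexx orbT.
  have s0itv : 0 <= s0 <= 1 by lra.
  (* Markov's inequality for [s0 ^+ Z n]; the factor [s0] cancels against the one in [iter_le]. *)
  have : (s0%:E * P (Z n @^-1` [set k | (k <= 1)%N]) <=
      (C1 * p ^+ n * s0)%:E)%E.
    apply: (@le_trans _ _ (\int[P]_w (s0 ^+ Z n w)%:E)%E); last first.
      have := @markov_cst 0 1 setT _ (past0 xi_indep) s0itv _ n.
      rewrite add0n PT expr1 mulr1 => -> //; rewrite lee_fin.
      by apply: HC1; rewrite lexx andbT; lra.
    rewrite -integral_cst//; apply: (@le_trans _ _
        (\int[P]_(w in Z n @^-1` [set k | (k <= 1)%N]) (s0 ^+ Z n w)%:E)%E).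
      apply: ge0_le_integral => //.
      - by move=> w _; rewrite lee_fin; lra.
      - exact: measurable_pow.
      - move=> w /= Zn; rewrite lee_fin -[leLHS]expr1 ler_wiXn2l//; lra.
    apply: ge0_subset_integral => //; first exact: measurable_pow.
    by move=> w _; rewrite lee_fin exprn_ge0//; lra.
  rewrite -probE// -EFinM lee_fin mulrC ler_pM2r//; lra.
- move=> m n eps e_gt0 ue.
  have mS := singles_measurable m; have mCS := measurableC mS.
  have := @prob_W_below_le eps (~` singles m) (C2 * p ^+ m * (C1 * p ^+ n) ^+ lambda)
    (m + n) e_gt0 mCS.
  move=> H; apply: le_trans (H _) _; last first.
    rewrite exprMn -exprM exprD.
    rewrite [leLHS](_ : _ = expR 1 * (C2 * C1 ^+ lambda) *
      (p ^+ m * p ^+ (n * lambda))); last by ring.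
    by rewrite ler_wpM2r ?mulr_ge0// !le_max lexx !orbT.
  move=> N mnN; have mN : (m <= N)%N by apply: leq_trans mnN; exact: leq_addr.
  pose l := (N - m)%N; have nl : (n <= l)%N by rewrite leq_subRL.
  rewrite -(subnKC mN) -/l; set s := laplace_point _ _.
  have sitv : 0 <= s <= 1 by exact: laplace_point_itv.
  have ae : 0 < a ^+ m * eps by rewrite mulr_gt0.
  have tle : iter l f s <= iter n f s0.
    rewrite /s laplace_pointD lap//.
    by rewrite mulrA -(mulrA u) -exprD addnC.
  have titv := iter_itv f_itv l sitv.
  have s0itv : 0 <= s0 <= 1 by lra.
  have ts0 : 0 <= iter l f s <= s0.
    case/andP: titv => -> _ /=; apply: le_trans tle _.
    exact: iter_le_id f_itv p01 lam1 f_le n s0 s0itv.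
  have IS := markov_cst (@past_singles m) sitv (@singles_cst m) l.
  have IT := total eps (m + l)%N e_gt0.
  (* With [t = iter l f s], the integral off [singles m] is [iter m f t - t * prob (singles m)],
     hence at most [iter m f t - p ^+ m * t]. This is the quantity bounded by [iter_sub_le], and [t]
     has order [p ^+ n]. *)
  have IU : (\int[P]_w (s ^+ Z (m + l) w)%:E =
      \int[P]_(w in singles m) (s ^+ Z (m + l) w)%:E +
      \int[P]_(w in ~` singles m) (s ^+ Z (m + l) w)%:E)%E.
    rewrite -[X in integral _ X](setUv (singles m)) ge0_integral_setU//.
    - exact: measurable_pow.
    - by move=> w _; rewrite lee_fin exprn_ge0//; case/andP: sitv.
    - by rewrite /disj_set setICr.
  rewrite -/s IU IS in IT.
  have ICS := integral_pow_le P (mZ (m + l)) mCS sitv.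
  move: IT ICS; case: integral => [r|_|_]; last 2 first.
  - by rewrite -probE// leye_eq andbF.
  - by rewrite leNye.
  rewrite -EFinD => -[E] _; rewrite lee_fin.
  have := HC2 m _ ts0; rewrite -iterD -E expr1.
  have := singles_ge m => sm.
  have := ler_wpM2l (proj1 (andP titv)) sm.
  have tl : iter l f s ^+ lambda <= (C1 * p ^+ n) ^+ lambda.
    apply: lerXn2r; rewrite ?nnegrE ?mulr_ge0 ?(ltW C10)//; first by case/andP: titv.
    exact: le_trans tle (s0C n).
  have := ler_wpM2l (mulr_ge0 (ltW C20) (p0 m)) tl.
  lra.
- move=> m n eps e_gt0 ae.
  apply: (@le_trans _ _ (1 / 4 * prob (branching m n))); last first.
    exact: (prob_W_below_cst (@past_branching m n) (@branching_cst m n)).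
  apply: (@le_trans _ _ (1 / 4 * (p ^+ m * nat_pmf P X lambda * (p ^+ lambda) ^+ n))).
    rewrite -exprM exprD [(lambda * n)%N]mulnC.
    rewrite [leRHS](_ : _ = 1 / 4 * nat_pmf P X lambda *
      (p ^+ m * p ^+ (n * lambda))); last by ring.
    by rewrite ler_wpM2r ?mulr_ge0// ge_min lexx orbT.
  by rewrite ler_wpM2l ?branching_ge//; lra.
Qed.

End SmallValues.

(** * Inferior and superior limits *)

Section LimitBounds.
Context (R : realType).

Lemma limf_esup_itv (f : R -> \bar R) (F : set_system R) (lo hi : \bar R) :
  ProperFilter F -> (\forall e \near F, (lo <= f e <= hi)%E) ->
  (lo <= limf_esup f F <= hi)%E.
Proof.
move=> FF Fb; apply/andP; split.
  apply: le_ereal_inf_tmp => _ [V FV <-].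
  have [e [Ve /andP[le _]]] := filter_ex (filterI FV Fb).
  by apply: le_trans le _; apply: ereal_sup_ubound; exists e.
apply: ge_ereal_inf.
exists (ereal_sup (f @` [set e | (lo <= f e <= hi)%E])).
  by exists [set e | (lo <= f e <= hi)%E].
by apply: ge_ereal_sup => _ [e /andP[_ eh] <-].
Qed.

Lemma limsup_0_itv (f : R -> R) (lo hi : R) :
  (\forall e \near (0 : R)^'+, lo <= f e <= hi) -> lo <= limsup_0 f <= hi.
Proof.
move=> fb.
have /andP[l h] : (lo%:E <= limf_esup (fun e => (f e)%:E) (0 : R)^'+ <= hi%:E)%E.
  by apply: limf_esup_itv; apply: filterS fb => e; rewrite !lee_fin.
rewrite -!lee_fin /limsup_0 fineK ?l ?h// fin_numE.
by rewrite -ltNye (lt_le_trans (ltNyr lo) l) -ltey (le_lt_trans h (ltry hi)).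
Qed.

Lemma liminf_0N (f : R -> R) : liminf_0 f = - limsup_0 (fun e => - f e).
Proof. by rewrite /liminf_0 /limsup_0 /limf_einf fineN. Qed.

Lemma liminf_0_itv (f : R -> R) (lo hi : R) :
  (\forall e \near (0 : R)^'+, lo <= f e <= hi) -> lo <= liminf_0 f <= hi.
Proof.
move=> fb; rewrite liminf_0N lerNr lerNl andbC; apply: limsup_0_itv.
by apply: filterS fb => e /andP[? ?]; rewrite !lerN2; apply/andP.
Qed.

(** The constants [c] and [C] do not depend on [x], whereas the range of [e] may; this is why the
    limits in [e] are taken before [x] grows. *)
Lemma asymp_liminf_limsup (g : R -> R -> R) (h : R -> R) (c C x0 : R) :
  0 < c -> (forall x : R, 0 < h x) ->
  (forall x : R, x0 <= x -> \forall e \near (0 : R)^'+,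
     c * h x <= g x e <= C * h x) ->
  asymp (fun x => liminf_0 (g x)) (fun x => limsup_0 (g x)) /\
  asymp (fun x => limsup_0 (g x)) h.
Proof.
move=> c0 h0 gb.
have cC : c <= C.
  have [e /andP[l u]] := @filter_ex R (0 : R)^'+ _ _ (gb x0 (lexx x0)).
  by rewrite -(ler_pM2r (h0 x0)) (le_trans l).
have C0 : 0 < C by exact: lt_le_trans cC.
have near_x0 : \forall x \near +oo, x0 <= x.
  by apply: nbhs_pinfty_ge; exact: num_real.
split.
  exists (c / C), (C / c); split; rewrite ?divr_gt0//.
  apply: filterS near_x0 => x /gb gx.
  have /andP[l1 u1] := liminf_0_itv gx; have /andP[l2 u2] := limsup_0_itv gx.
  have ch : 0 < c * h x by rewrite mulr_gt0.
  have s0 : 0 < limsup_0 (g x) by exact: lt_le_trans l2.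
  apply/andP; split.
    rewrite ler_pdivlMr// mulrAC ler_pdivrMr//.
    apply: (@le_trans _ _ (c * (C * h x))); first by rewrite ler_pM2l.
    by rewrite mulrCA mulrC ler_pM2r.
  rewrite ler_pdivrMr// mulrAC ler_pdivlMr//.
  apply: (@le_trans _ _ (C * h x * c)); first by rewrite ler_pM2r.
  by rewrite -mulrA ler_pM2l// mulrC.
exists c, C; split => //; apply: filterS near_x0 => x /gb gx.
by have := limsup_0_itv gx; rewrite ler_pdivlMr// ler_pdivrMr.
Qed.

End LimitBounds.

(** * The logarithmic scale and real exponents *)

Section Gamma.
Context (R : realType) (a : R).
Hypothesis a_gt1 : 1 < a.

Lemma powR_gamma (eps : R) : 0 < eps -> a `^ gamma_s a eps = eps^-1.
Proof.
move=> e0; have a0 : 0 < a by exact: lt_trans a_gt1.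
rewrite /powR gt_eqF// /gamma_s mulfVK; last by rewrite gt_eqF// ln_gt0.
by rewrite lnK ?posrE ?div1r// invr_gt0.
Qed.

Lemma gamma_le_expn (eps : R) n k : 0 < eps ->
  gamma_s a eps + k%:R <= n%:R -> a ^+ k <= a ^+ n * eps.
Proof.
move=> e0 gn; have a0 : 0 < a by exact: lt_trans a_gt1.
rewrite -ler_pdivrMr// -(powR_gamma e0) -!powR_mulrn ?(ltW a0)//.
rewrite -powRD; last by rewrite (gt_eqF a0) implybT.
by apply: ler_powR; rewrite ?(ltW a_gt1)// addrC.
Qed.

Lemma gamma_ge_expn (eps : R) n k : 0 < eps ->
  n%:R + k%:R <= gamma_s a eps -> a ^+ k * a ^+ n * eps <= 1.
Proof.
move=> e0 gn; have a0 : 0 < a by exact: lt_trans a_gt1.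
rewrite -ler_pdivlMr// div1r -(powR_gamma e0) -!powR_mulrn ?(ltW a0)//.
rewrite -powRD; last by rewrite (gt_eqF a0) implybT.
by apply: ler_powR; rewrite ?(ltW a_gt1)// addrC.
Qed.

Lemma gamma_near (M : R) : \forall eps \near (0 : R)^'+, M <= gamma_s a eps.
Proof.
have a0 : 0 < a by exact: lt_trans a_gt1.
near=> eps.
have e0 : 0 < eps by near: eps; exact: nbhs_right_gt.
have eM : eps <= expR (- (M * ln a)).
  by near: eps; apply: nbhs_right_le; exact: expR_gt0.
rewrite /gamma_s ler_pdivlMr ?ln_gt0// div1r lnV ?posrE// lerNr.
by rewrite -(expRK (- _)) ler_ln ?posrE ?expR_gt0.
Unshelve. all: by end_near. Qed.

Lemma expn_unbounded (M : R) : exists k, M <= a ^+ k.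
Proof.
have a0 : 0 < a by exact: lt_trans a_gt1.
have [M0|M0] := leP M 0; first by exists 0%N; rewrite expr0 (le_trans M0).
exists (Num.truncn (ln M / ln a)).+1.
rewrite -ler_ln ?posrE ?exprn_gt0// lnXn// -mulr_natl -ler_pdivrMr ?ln_gt0//.
by rewrite ltW// truncnS_gt.
Qed.

End Gamma.

Section PowR.
Context (R : realType) (p : R).
Hypothesis p_itv : 0 < p < 1.

Lemma expn_le_powR n (y : R) : y <= n%:R -> p ^+ n <= p `^ y.
Proof.
have /andP[p0 p1] := p_itv => yn; rewrite -powR_mulrn ?(ltW p0)//.
by rewrite ger_powR// p0 ltW.
Qed.

Lemma powR_le_expn n (y : R) : n%:R <= y -> p `^ y <= p ^+ n.
Proof.
have /andP[p0 p1] := p_itv => yn; rewrite -powR_mulrn ?(ltW p0)//.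
by rewrite ger_powR// p0 ltW.
Qed.

End PowR.

(** * Events of the first exceedance time *)

Section FirstExceed.
Context (T : Type) (R : realType) (Z : nat -> T -> nat).

(** If some generation exceeds 1, the infimum is attained at the first such one, so strict
    inequality is preserved; if none does, the infimum is [+oo] and both sides hold. *)
Lemma first_exceed_gt (g x : R) :
  [set w | (x%:E < first_exceed R Z w - g%:E)%E] =
  \bigcap_(n in [set n | n%:R <= x + g]) Z n @^-1` [set k | (k <= 1)%N].
Proof.
have E w : (x%:E < first_exceed R Z w - g%:E)%E =
    ((x + g)%:E < first_exceed R Z w)%E by rewrite lteBrDr// -EFinD.
apply/seteqP; split => w; rewrite /mkset E => H.
  move=> n /= nx; rewrite /preimage/= leqNgt; apply/negP => Zn.
  have : (first_exceed R Z w <= n%:R%:E)%E.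
    by apply: ereal_inf_lbound; exists n.
  by apply/negP; rewrite -ltNge (le_lt_trans _ H)// lee_fin.
have [ex|nex] := pselect (exists n, (1 < Z n w)%N); last first.
  rewrite /first_exceed (_ : [set _ | n in _] = set0) ?ereal_inf0 ?ltry//.
  by apply/seteqP; split => [y [n Zn _]|//]; case: nex; exists n.
case: (ex_minnP ex) => m Zm m_min.
apply: (@lt_le_trans _ _ m%:R%:E).
  rewrite lte_fin ltNge; apply/negP => /H /=.
  by rewrite /preimage/= leqNgt Zm.
by apply: le_ereal_inf_tmp => _ [n Zn <-]; rewrite lee_fin ler_nat m_min.
Qed.

Lemma first_exceed_lt (g x : R) :
  [set w | (first_exceed R Z w - g%:E < (- x)%:E)%E] =
  \bigcup_(n in [set n | n%:R < g - x]) Z n @^-1` [set k | (1 < k)%N].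
Proof.
have E w : (first_exceed R Z w - g%:E < (- x)%:E)%E =
    (first_exceed R Z w < (g - x)%:E)%E by rewrite lteBlDr// -EFinD addrC.
apply/seteqP; split => w; rewrite /mkset E.
  by move=> /ereal_inf_lt[_ [n Zn <-]]; rewrite lte_fin => ng; exists n.
move=> [n /= ng Zn]; apply: (@le_lt_trans _ _ n%:R%:E); last by rewrite lte_fin.
by apply: ereal_inf_lbound; exists n.
Qed.

End FirstExceed.

(** * Rounding to generations and conclusion *)

Lemma truncn_bounds (R : realType) (y : R) : 0 <= y ->
  y - 1 < (Num.truncn y)%:R <= y.
Proof.
by move=> y0; rewrite ltrBlDr natr1; case/andP: (truncn_itv y0) => -> ->.
Qed.

Theorem theorem1p1 (d : measure_display) (T : measurableType d) (R : realType)
  (P : probability T R)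
  (X : {RV P >-> nat})
  (X_pos : nat_pmf P X 0 = 0)
  (X_nondegenerate : forall k, nat_pmf P X k != 1)
  (X_logX : (mean_xlogx P X < +oo)%E)
  (xi : nat * nat -> {RV P >-> nat})
  (xi_indep : mutually_independent P xi)
  (xi_law : forall ni k, nat_pmf P (xi ni) k = nat_pmf P X k)
  (W : {RV P >-> R})
  (W_lim : {ae P, forall w,
     (galton_watson xi n w)%:R / nat_mean P X ^+ n @[n --> \oo] --> W w})
  (schroder : 0 < nat_pmf P X 1)
  (lambda : nat)
  (lambda_least :
     is_least [set k | (1 < k)%N /\ nat_pmf P X k != 0] lambda) :
  let a := nat_mean P X in
  let p1 := nat_pmf P X 1 in
  let K : T -> \bar R := first_exceed R (galton_watson xi) in
  let W_lt (eps : R) := [set w | W w < eps] in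
  let upper (x eps : R) :=
    cond_prob P [set w | (x%:E < K w - (gamma_s a eps)%:E)%E] (W_lt eps) in
  let lower (x eps : R) :=
    cond_prob P [set w | (K w - (gamma_s a eps)%:E < (- x)%:E)%E] (W_lt eps) in
  (asymp (fun x => liminf_0 (upper x)) (fun x => limsup_0 (upper x)) /\
   asymp (fun x => limsup_0 (upper x)) (fun x => p1 `^ x)) /\
  (asymp (fun x => liminf_0 (lower x)) (fun x => limsup_0 (lower x)) /\
   asymp (fun x => limsup_0 (lower x))
         (fun x => p1 `^ ((lambda%:R - 1) * x))).
Proof.
move=> a p K W_lt upper lower.
have p01 : 0 < p < 1 := p1_itv X_nondegenerate schroder.
have /andP[p0 p1] := p01.
have a1 : 1 < a :=
  nat_mean_gt1 X_pos X_nondegenerate X_logX schroder lambda_least.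
have lam1 := lambda_gt1 lambda_least.
have [c [C [u [c0 C0 u0 [H1 H2 H3 H4 H5]]]]] := small_value_bounds X_pos
  X_nondegenerate X_logX xi_indep xi_law W_lim schroder lambda_least.
rewrite -/a -/p in H1 H2 H3 H4 H5.
(* [k1] and [k2] turn the factors [4 * lambda] and [u] into shifts of the generation index. *)
have [k1 Hk1] := expn_unbounded a1 (4 * lambda%:R).
have [k2 Hk2] := expn_unbounded a1 u.
have Hk1' : 4 <= a ^+ k1.
  by apply: le_trans Hk1; rewrite ler_peMr// ler1n ltnW.
pose g := gamma_s a.
have big eps n : 0 < eps -> g eps + k1%:R <= n%:R ->
    4 * lambda%:R <= a ^+ n * eps.
  by move=> e0 gn; apply: le_trans Hk1 _; exact: gamma_le_expn.
have small eps n : 0 < eps -> n%:R + k2%:R <= g eps -> u * a ^+ n * eps <= 1.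
  move=> e0 gn; apply: le_trans (gamma_ge_expn a1 e0 gn).
  by rewrite ler_wpM2r ?(ltW e0)// ler_wpM2r// exprn_ge0// (le_trans _ (ltW a1)).
have pw y : 0 < p `^ y by exact: powR_gt0.
have pD y z : p `^ (y + z) = p `^ y * p `^ z.
  by rewrite powRD// (gt_eqF p0) implybT.
have mW eps : measurable (W_below W eps) := W_below_measurable W eps.
have mZ := galton_watson_measurable xi_indep.
have mS n : measurable (singles xi n) := singles_measurable xi_indep n.
have mB m n : measurable (branching xi lambda m n) :=
  branching_measurable xi_indep lambda m n.
(* The denominator is evaluated at the integer parts of [g eps + k1 + 1] and [g eps - k2]; each
   truncation moves the exponent by at most 1. *)
pose cF := c * p `^ (k1%:R + 1); pose CF := C * p `^ (- k2%:R - 1).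
have cF0 : 0 < cF by rewrite mulr_gt0.
have CF0 : 0 < CF by rewrite mulr_gt0.
have Flow eps : 0 < eps -> 0 <= g eps ->
    cF * p `^ g eps <= prob P (W_below W eps).
  move=> e0 g0; have gk : 0 <= g eps + k1%:R + 1 by rewrite !addr_ge0.
  have /andP[n1 n2] := truncn_bounds gk; set n := Num.truncn _ in n1 n2.
  apply: (@le_trans _ _ (prob P (singles xi n `&` W_below W eps))); last first.
    by apply: prob_le => //; exact: measurableI.
  have gn : g eps + k1%:R <= n%:R by lra.
  apply: le_trans (H1 n eps e0 _); last first.
    by apply: le_trans (gamma_le_expn a1 e0 gn).
  rewrite /cF -mulrA ler_pM2l// -pD; apply: powR_le_expn => //; lra.
have Fup eps : 0 < eps -> k2%:R <= g eps ->
    prob P (W_below W eps) <= CF * p `^ g eps.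
  move=> e0 gk; have gk' : 0 <= g eps - k2%:R by lra.
  have /andP[n1 n2] := truncn_bounds gk'; set n := Num.truncn _ in n1 n2.
  apply: le_trans (H2 n eps e0 _) _; first by apply: small => //; lra.
  rewrite /CF -mulrA ler_pM2l// -pD; apply: expn_le_powR => //; lra.
(* Dividing by [W < eps], whose probability lies between [cF] and [CF] times [p] to the power
   [g eps], removes that power and leaves [h]. *)
have ratio eps (A : set T) (l r h : R) : 0 < eps -> k2%:R <= g eps ->
    0 <= l -> 0 <= r -> measurable A ->
    l * (p `^ g eps * h) <= prob P (A `&` W_below W eps) <=
      r * (p `^ g eps * h) ->
    0 < h ->
    l / CF * h <= cond_prob P A (W_lt eps) <= r / cF * h.
  move=> e0 gk l0 r0 mA /andP[lA rA] h0.
  have g0 : 0 <= g eps by apply: le_trans gk.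
  have Fl := Flow eps e0 g0; have Fu := Fup eps e0 gk.
  have F0 : 0 < prob P (W_below W eps).
    by apply: lt_le_trans Fl; rewrite mulr_gt0.
  rewrite /cond_prob -/(prob P _) -/(prob P (W_lt eps)) -/(W_below W eps).
  rewrite ler_pdivlMr// ler_pdivrMr//; apply/andP; split.
    apply: le_trans lA.
    apply: (@le_trans _ _ (l / CF * h * (CF * p `^ g eps))).
      by rewrite ler_wpM2l// mulr_ge0 ?divr_ge0 ?(ltW CF0) ?(ltW h0).
    by rewrite le_eqVlt; apply/orP; left; apply/eqP; field; rewrite gt_eqF.
  apply: (le_trans rA).
  apply: (@le_trans _ _ (r / cF * h * (cF * p `^ g eps))).
    by rewrite le_eqVlt; apply/orP; left; apply/eqP; field; rewrite gt_eqF.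
  by rewrite ler_wpM2l// mulr_ge0 ?divr_ge0 ?(ltW cF0) ?(ltW h0).
have eps_gt0 : \forall eps \near (0 : R)^'+, 0 < eps by exact: nbhs_right_gt.
split.
  (* The truncation [N] of [x + g eps] exceeds [x + g eps - 1]: this gives the factor [p] to the
     power -1, and for [x >= k1 + 1] it makes [N] large enough for the lower bound [H1]. *)
  apply: (@asymp_liminf_limsup _ _ _ (c / CF)
    (C * p `^ (- 1) / cF) (k1%:R + 1)).
  - by rewrite divr_gt0.
  - by move=> x; exact: pw.
  move=> x xk; near=> eps.
  have e0 : 0 < eps by near: eps.
  have gk : k2%:R <= g eps by near: eps; exact: gamma_near.
  have g0 : 0 <= g eps by apply: le_trans gk.
  have k10 : 0 <= k1%:R :> R by [].
  rewrite /upper /K first_exceed_gt -/(g eps).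
  set U := \bigcap_(n in _) _.
  have mU : measurable U.
    apply: bigcap_measurable; first by exists 0%N => /=; lra.
    by move=> n _; exact: nat_measurable_preimage (mZ n).
  apply: ratio => //; first by rewrite ltW.
    by rewrite mulr_ge0// ltW.
  have xg : 0 <= x + g eps by lra.
  have /andP[n1 n2] := truncn_bounds xg; set N := Num.truncn _ in n1 n2.
  apply/andP; split.
    apply: (@le_trans _ _ (prob P (singles xi N `&` W_below W eps))).
      apply: le_trans (H1 N eps e0 _); last first.
        apply: le_trans Hk1' _; apply: gamma_le_expn => //; rewrite -/(g eps); lra.
      by rewrite ler_pM2l// -pD; apply: powR_le_expn => //; lra.
    apply: prob_le; [exact: measurableI|exact: measurableI|].
    apply: setSI => w Bw n /= nx; rewrite /preimage/= Bw//.
    by rewrite -ltnS -(ltr_nat R) -natr1; lra.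
  (* The condition [W < eps] is dropped here without loss of order. *)
  apply: (@le_trans _ _ (prob P (galton_watson xi N @^-1` [set k | (k <= 1)%N]))).
    apply: prob_le; [exact: measurableI|exact: nat_measurable_preimage (mZ N)|].
    by move=> w [Uw _]; apply: Uw.
  apply: le_trans (H3 N) _.
  rewrite -mulrA ler_pM2l// -!pD; apply: expn_le_powR => //; lra.
pose L : R := lambda%:R.
have L0 : 0 <= L by [].
(* The shifts [k1 + 3] and [k2 + 1] are multiplied by [L], because they count generations with
   [lambda] individuals. *)
apply: (@asymp_liminf_limsup _ _ _ (c * p `^ (L * (k1%:R + 3)) / CF)
  (C * p `^ (- 1 - L * (k2%:R + 1)) / cF) (k2%:R)).
- by rewrite divr_gt0// mulr_gt0.
- by move=> x; exact: pw.
move=> x xk; near=> eps.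
have e0 : 0 < eps by near: eps.
have gx : x + k2%:R + 3 <= g eps by near: eps; exact: gamma_near.
have k20 : 0 <= k2%:R :> R by [].
have k10 : 0 <= k1%:R :> R by [].
rewrite /lower /K first_exceed_lt -/(g eps).
set U := \bigcup_(n in _) _.
have mU : measurable U.
  by apply: bigcup_measurable => // n _; exact: nat_measurable_preimage (mZ n).
have gx0 : 0 <= g eps - x by lra.
have /andP[m1 m2] := truncn_bounds gx0; set m := Num.truncn _ in m1 m2.
apply: ratio => //.
- by lra.
- by rewrite mulr_ge0// ltW.
- by rewrite mulr_ge0// ltW.
apply/andP; split.
  have m_gt1 : (1 < m)%N by rewrite -(ltr_nat R); lra.
  (* [m] may equal [g eps - x], while the branching generation [m'.+1] must lie strictly below it,
     hence the shift by 2. The 3 in [n] makes up for the two truncations and for this last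
     generation. *)
  pose m' := m.-2; have mE : m = m'.+2 by rewrite /m'; case: (m) m_gt1 => [|[|]].
  have x0 : 0 <= x by lra.
  have /andP[n1 n2] := truncn_bounds x0; set n' := Num.truncn _ in n1 n2.
  pose n := (n' + k1 + 3)%N.
  have nE : n%:R = n'%:R + k1%:R + 3 :> R by rewrite /n !natrD.
  have mR : m%:R = m'%:R + 2 :> R by rewrite mE -addn2 natrD.
  apply: (@le_trans _ _ (prob P (branching xi lambda m' n `&` W_below W eps))).
    apply: le_trans (H5 m' n eps e0 _); last first.
      by apply: big => //; rewrite natrD -natr1; lra.
    rewrite -mulrA ler_pM2l// -!pD; apply: powR_le_expn => //.
    rewrite natrD natrM -/L nE; nra.
  apply: prob_le; [exact: measurableI|exact: measurableI|].
  apply: setSI => w [_ Lw]; exists m'.+1 => /=.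
    by rewrite -natr1; lra.
  by have := Lw 0%N isT; rewrite addn0 /preimage/= => ->.
(* The generations split as [m <= g eps - x] and [n <= x - k2], so that [m + n + k2 <= g eps] as
   [H4] requires. *)
have xk0 : 0 <= x - k2%:R by lra.
have /andP[n1 n2] := truncn_bounds xk0; set n := Num.truncn _ in n1 n2.
apply: (@le_trans _ _ (prob P (~` singles xi m `&` W_below W eps))).
  apply: prob_le; [exact: measurableI| |].
    by apply: measurableI => //; exact: measurableC.
  apply: setSI => w [n' /= n'g Zn'] Bw.
  have n'm : (n' <= m)%N by rewrite -ltnS -(ltr_nat R) -natr1; lra.
  by move: Zn'; rewrite /preimage/= Bw.
apply: le_trans (H4 m n eps e0 _) _.
  by apply: small => //; rewrite natrD; lra.
rewrite -mulrA ler_pM2l// -!pD; apply: expn_le_powR => //.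
rewrite natrD natrM -/L; nra.
Unshelve. all: by end_near. Qed.
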